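(* The betweenness centrality $BC(v)$ of all vertices $v$ of a connected undirected unweighted graph $G$ on $n$ vertices can be computed in time $O(n^{\omega}\,Diam(G))$.
   Context: $d(s,t)$ is the shortest-path distance, $Diam(G)=\max d(s,t)$. $\lambda_{st}$ is the number of shortest $s$–$t$ paths, $\lambda_{st}(v)$ the number of those through $v$, $\delta_{st}(v)=\lambda_{st}(v)/\lambda_{st}$, and $BC(v)=\sum_{s,t:\, s\ne v\ne t}\delta_{st}(v)$. $\omega<2.376$ is the exponent of matrix multiplication. Running time is measured in the model where every arithmetic operation takes unit time and every number uses unit space, regardless of size. *)

(* Defs.v *)
From HB Require Import structures.
From mathcomp Require Import all_boot all_order all_algebra.
From mathcomp Require Import all_classical all_reals.
From mathcomp Require Import exp Rstruct.
Set Implicit Arguments.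
Unset Strict Implicit.
Unset Printing Implicit Defensive.
Import Order.TTheory GRing.Theory Num.Theory.
Local Open Scope ring_scope.

Definition simple_graph (n : nat) (adj : rel 'I_n) : Prop :=
  irreflexive adj /\ symmetric adj.

Definition connected_graph (n : nat) (adj : rel 'I_n) : Prop :=
  forall s t : 'I_n, connect adj s t.

Definition walks (n : nat) (adj : rel 'I_n) (k : nat) (s t : 'I_n)
  : {set k.-tuple 'I_n} :=
  [set p : k.-tuple 'I_n | path adj s p && (last s p == t)].

(* shortest-path distance d(s,t): least k with a walk of length k
   (in a connected graph on n vertices this k is < n). *)
Definition dist (n : nat) (adj : rel 'I_n) (s t : 'I_n) : nat :=
  find (fun k => 0 < #|walks adj k s t|)%N (iota 0 n).

Definition diam (n : nat) (adj : rel 'I_n) : nat :=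
  \max_(s : 'I_n) \max_(t : 'I_n) dist adj s t.

Definition nb_sp (n : nat) (adj : rel 'I_n) (s t : 'I_n) : nat :=
  #|walks adj (dist adj s t) s t|.

Definition nb_sp_through (n : nat) (adj : rel 'I_n) (s t v : 'I_n) : nat :=
  #|[set p in walks adj (dist adj s t) s t | v \in s :: (p : seq 'I_n)]|.

Definition delta (n : nat) (adj : rel 'I_n) (s t v : 'I_n) : rat :=
  (nb_sp_through adj s t v)%:R / (nb_sp adj s t)%:R.

Definition BC (n : nat) (adj : rel 'I_n) (v : 'I_n) : rat :=
  \sum_(s : 'I_n | s != v) \sum_(t : 'I_n | t != v) delta adj s t v.

(* Unit-cost arithmetic RAM: registers indexed by nat hold arbitrary    *)
(* rationals; every instruction costs one step.                        *)

Inductive instr : Type :=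
| IConst of nat & rat
| IAdd of nat & nat & nat
| ISub of nat & nat & nat
| IMul of nat & nat & nat
| IDiv of nat & nat & nat        (* R[d] := R[a] / R[b]  (x/0 = 0)   *)
| ILoad of nat & nat
| IStore of nat & nat
| IJz of nat & nat
| IJlt of nat & nat
| IJmp of nat
| IHalt.

Definition program := seq instr.

Record state := State { pc : nat; regs : nat -> rat }.

Definition addr (q : rat) : nat := `|Num.floor q|%N.

Definition upd (m : nat -> rat) (d : nat) (q : rat) : nat -> rat :=
  fun i => if i == d then q else m i.

Definition halted (P : program) (st : state) : bool :=
  if nth IHalt P (pc st) is IHalt then true else false.

Definition step (P : program) (st : state) : state :=
  let m := regs st in
  let nx := (pc st).+1 in
  match nth IHalt P (pc st) with
  | IConst d q => State nx (upd m d q)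
  | IAdd d a b => State nx (upd m d (m a + m b))
  | ISub d a b => State nx (upd m d (m a - m b))
  | IMul d a b => State nx (upd m d (m a * m b))
  | IDiv d a b => State nx (upd m d (m a / m b))
  | ILoad d a => State nx (upd m d (m (addr (m a))))
  | IStore a b => State nx (upd m (addr (m a)) (m b))
  | IJz a l => State (if m a == 0 then l else nx) m
  | IJlt a l => State (if m a < 0 then l else nx) m
  | IJmp l => State l m
  | IHalt => st
  end.

Definition run (P : program) (T : nat) (st : state) : state :=
  iter T (step P) st.

Definition graph_input (n : nat) (adj : rel 'I_n) : state :=
  State 0 (fun k => if k == 0%N then n%:R else
             if [pick ij : 'I_n * 'I_n | (1 + ij.1 * n + ij.2)%N == k]
               is Some ij then (adj ij.1 ij.2)%:R
             else 0).

Definition mm_input (n : nat) (A B : 'M[rat]_n) : state :=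
  State 0 (fun k => if k == 0%N then n%:R else
             if [pick ij : 'I_n * 'I_n | (1 + ij.1 * n + ij.2)%N == k]
               is Some ij then A ij.1 ij.2
             else if [pick ij : 'I_n * 'I_n |
                        (1 + n * n + ij.1 * n + ij.2)%N == k]
               is Some ij then B ij.1 ij.2
             else 0).

Definition matmul_in_time (c : Rdefinitions.R) : Prop :=
  exists (Q : program) (K : Rdefinitions.R) (N0 : nat),
    forall (n : nat) (A B : 'M[rat]_n), (0 < n)%N -> (N0 <= n)%N ->
      exists T : nat,
        let st := run Q T (mm_input A B) in
        [/\ halted Q st,
            (forall i j : 'I_n, regs st (1 + i * n + j)%N = (A *m B) i j) &
            (T%:R <= K * powR (n%:R) c)%R].

(* Main.v *)
(* Walk counts are the entries of the powers A^k of the adjacency matrix, so d(s,t) and lambda_st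
   are read off at the first k with (A^k)_st <> 0; this takes Diam(G) matrix products.  With
   Y_sw the sum of lambda_wt / lambda_st over the t with d(s,w) + d(w,t) = d(s,t), one has
     Y_sw = 1 / lambda_sw + sum of Y_su over the neighbours u of w with d(s,u) = d(s,w) + 1,
   so Y is obtained level by level, from the farthest level down, with one product by A per level;
   finally BC(v) = sum_s lambda_sv Y_sv - (2n - 1).

   The given multiplication program Q may use any register, at rational addresses.  It is simulated
   with its memory shifted by an integer L beyond all private data; Q's writes are logged
   and undone after each product, because Q expects zeros outside its input.  Since Q must overwrite
   n^2 output registers, its running time also dominates the O(n^2) work around every product. *)
Require Import Defs.
From HB Require Import structures.
From mathcomp Require Import all_boot all_order all_algebra.
From mathcomp Require Import all_classical all_reals.
From mathcomp Require Import exp Rstruct.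
From mathcomp Require Import zify ring.
Import Order.TTheory GRing.Theory Num.Theory.
Set Implicit Arguments.
Unset Strict Implicit.
Unset Printing Implicit Defensive.
Local Open Scope ring_scope.

(** The shift L must be fixed before the first product, yet the log placed in front of the simulated
    memory grows with the running time of [Q], which is bounded only by [K * n^c] for real [K] and
    [c]. The program therefore computes the integer [a * n ^ m1], with naturals [a] above |K| and
    [m1] above |c|, and reserves that much room for the writes of [Q]. Its degree may exceed [c]:
    reserved cells cost nothing, only executed steps do. For the same reason the simulated memory
    cannot be cleaned by a sweep, whereas undoing the log costs no more, up to a constant, than the
    writes themselves. Taking n at least 32 confines the overlap of the scalars with the input to
    the first row of the adjacency matrix, and gives Diam(G) >= 1, so that the Diam(G) + 1 levels
    including level 0 still cost O(Diam(G)) products. *)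

Lemma addr_nat (k : nat) : addr k%:R = k.
Proof. by rewrite /addr -[k%:R]/((k%:Z)%:~R) intrKfloor. Qed.

(* The machine has no floor instruction, but an integer shift commutes with the floor in [addr]. *)
Lemma addr_shift (q : rat) (l : nat) :
  addr (if q < 0 then q - l%:R else q + l%:R) = (l + addr q)%N.
Proof.
have h (z : int) : Num.floor (q + z%:~R) = Num.floor q + z.
  by rewrite floorDrz ?intr_int // intrKfloor.
rewrite /addr; case: ltP => q0.
  have : Num.floor q < 0 by rewrite floor_lt0.
  rewrite (_ : q - l%:R = q + (- l%:Z)%:~R) ?h; last by rewrite mulrNz.
  by lia.
have : 0 <= Num.floor q by rewrite floor_ge0.
by rewrite (_ : q + l%:R = q + (l%:Z)%:~R) // h; lia.
Qed.

(** * Relocatable code and its execution *)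

Notation memory := (nat -> rat).

(** Jump targets are absolute, so a fragment is a function of the address at which it is loaded. *)
Definition code := nat -> seq instr.

Definition placed (P : program) (b : nat) (c : seq instr) :=
  forall i, (i < size c)%N -> nth IHalt P (b + i) = nth IHalt c i.

Lemma placed_cat P b c1 c2 :
  placed P b (c1 ++ c2) -> placed P b c1 /\ placed P (b + size c1) c2.
Proof.
move=> h; split=> i hi.
  by rewrite h ?nth_cat ?hi // size_cat; lia.
rewrite -addnA h ?size_cat ?ltn_add2l // nth_cat.
by rewrite ltnNge leq_addr /= addKn.
Qed.

Lemma runD P T1 T2 st : run P (T1 + T2) st = run P T2 (run P T1 st).
Proof. by rewrite /run addnC iterD. Qed.

Lemma run_step P T st : run P T.+1 st = run P T (step P st).
Proof. by rewrite /run iterSr. Qed.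

Definition cseq (c1 c2 : code) : code :=
  fun b => c1 b ++ c2 (b + size (c1 b))%N.

(** The exit target skips the test, the body and the jump back, whence
    [b + 2 + size (body b.+1)]. *)
Definition cwhile (r : nat) (body : code) : code := fun b =>
  IJz r (b + 2 + size (body b.+1)) :: body b.+1 ++ [:: IJmp b].

Lemma placed_cons P b i c : placed P b (i :: c) ->
  nth IHalt P b = i /\ placed P b.+1 c.
Proof.
move=> h; split; first by have := h 0%N; rewrite addn0 => ->.
by move=> j hj; rewrite addSnnS h.
Qed.

Lemma run_while_stop P b r body m : placed P b (cwhile r body b) -> m r = 0 ->
  run P 1 (State b m) = State (b + size (cwhile r body b)) m.
Proof.
move=> /placed_cons [h _] mr; rewrite run_step /step /= h mr eqxx /run /=.
by congr State; rewrite size_cat /=; lia.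
Qed.

Lemma run_while_step P b r body m T m' : placed P b (cwhile r body b) -> m r != 0 ->
  run P T (State b.+1 m) = State (b.+1 + size (body b.+1)) m' ->
  run P (T + 2) (State b m) = State b m'.
Proof.
move=> /placed_cons [h /placed_cat [p1 /placed_cons [h2 _]]] mr e.
by rewrite addn2 -addn1 run_step /step /= h (negbTE mr) runD e run_step /step /= h2.
Qed.

Definition straight (i : instr) : bool :=
  match i with IJz _ _ | IJlt _ _ | IJmp _ | IHalt => false | _ => true end.

(** Control instructions leave memory alone, so this is the memory effect of every instruction, not
    only of straight-line ones. *)
Definition eval1 (m : memory) (i : instr) : memory :=
  match i with
  | IConst d q => upd m d q
  | IAdd d a b => upd m d (m a + m b)
  | ISub d a b => upd m d (m a - m b)
  | IMul d a b => upd m d (m a * m b)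
  | IDiv d a b => upd m d (m a / m b)
  | ILoad d a => upd m d (m (addr (m a)))
  | IStore a b => upd m (addr (m a)) (m b)
  | _ => m
  end.

Lemma run_straight P b (c : seq instr) m : all straight c -> placed P b c ->
  run P (size c) (State b m) = State (b + size c) (foldl eval1 m c).
Proof.
elim: c b m => [|i c IH] b m; first by rewrite addn0.
case/andP=> si sc /placed_cons [h hp].
rewrite run_step addnS -addSn -(IH b.+1) //; congr run.
by rewrite /step /= h; case: i si {h}.
Qed.

(** * Abstract states *)

(* Memory layout: registers 0-31 are scalars ([sc]); then arrays t = 0..6 ([ar]) of n^2 cells, cell k
   of array t being register t n^2 + 1 + k; then the log ([lg]), which stores the addresses written in the
   simulated memory ([qm]), which comes last.
   Scalars: 0: n, 1: 1, 2: n^2, 3: start of the simulated memory, 4: next log entry, 8: loop index,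
   9: loop condition, 10: scratch address, 11: start of the log, 16: distance level, 20 + t: base of array t.
   Arrays: 0: input and output, 1: adjacency matrix, 2: left factor, 3: product, 4: distances,
   5: lambda, 6: dependencies.  Array 0 overlaps the scalars, whence the conditions [32 <= _]. *)
Record abstract := Abstract {
  sc : nat -> rat;
  ar : nat -> nat -> rat;
  qm : nat -> rat;
  lg : seq nat }.

Definition with_sc s x := Abstract x (ar s) (qm s) (lg s).
Definition with_ar s x := Abstract (sc s) x (qm s) (lg s).

Definition upda (a : nat -> nat -> rat) (t k : nat) (q : rat) :=
  fun t' k' => if (t' == t) && (k' == k) then q else a t' k'.

Definition log_start (n : nat) := (7 * (n * n) + 1)%N.
Definition q_start (n B : nat) := (log_start n + B)%N.

Definition constants (n B : nat) (r : nat -> rat) : Prop :=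
  [/\ r 0%N = n%:R, r 1%N = 1, r 2%N = (n * n)%:R, r 3%N = (q_start n B)%:R &
      r 11%N = (log_start n)%:R /\
      forall t, (t < 7)%N -> r (20 + t)%N = (t * (n * n) + 1)%:R].

(** Register 10 is left free because each array access computes its address there. Log cells are
    known only through [addr]: they hold the rational addresses themselves, which the machine cannot
    round. [B] is the capacity of the log. *)
Definition rep (n B : nat) (s : abstract) (m : memory) : Prop :=
  [/\ forall r, (r < 32)%N -> r != 10%N -> m r = sc s r,
      forall t k, (t < 7)%N -> (k < n * n)%N -> (32 <= t * (n * n) + 1 + k)%N ->
        m (t * (n * n) + 1 + k)%N = ar s t k,
      forall k, m (q_start n B + k)%N = qm s k,
      forall i, (i < size (lg s))%N ->
        (i < B)%N /\ addr (m (log_start n + i)%N) = (q_start n B + nth 0%N (lg s) i)%N &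
      constants n B (sc s)].

(** The excluded registers hold the constants of the layout, apart from the scratch register 10;
    those from 20 on hold the array bases. *)
Definition writable (d : nat) := (d < 20)%N && (d \notin [:: 0; 1; 2; 3; 10; 11]%N).
Definition readable (a : nat) := (a < 32)%N && (a != 10%N).

Section Rep.
Variables (n B : nat).
Hypothesis n32 : (32 <= n)%N.

Lemma writableP d : writable d ->
  [/\ (d < 20)%N, d != 0%N, d != 1%N, d != 2%N & [/\ d != 3%N, d != 10%N & d != 11%N]].
Proof. by rewrite /writable !inE !negb_or => /and5P [-> -> -> -> /and3P [-> -> ->]]. Qed.

Lemma large_square : (32 <= n * n)%N. Proof. by nia. Qed.

Lemma rep_sc s m d v : writable d -> rep n B s m ->
  rep n B (with_sc s (upd (sc s) d v)) (upd m d v).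
Proof.
move=> /writableP [d20 d0 d1 d2 [d3 d10 d11]] [hs ha hq hl [c0 c1 c2 c3 [c11 ct]]].
have n2 := large_square; split=> /=.
- by move=> r r32 r10; rewrite /upd; case: eqP => // _; apply: hs.
- by move=> t k t7 kn h; rewrite /upd ifN ?ha //; lia.
- by move=> k; rewrite /upd ifN ?hq // /q_start /log_start; lia.
- move=> i /hl [iB e]; split=> //.
  by rewrite /upd ifN // /log_start; lia.
- split; rewrite /upd ?ifN // 1?eq_sym //.
  split; rewrite ?ifN // 1?eq_sym // => t t7.
  by rewrite ifN ?ct //; lia.
Qed.

Lemma rep_scratch s m v : rep n B s m -> rep n B s (upd m 10 v).
Proof.
move=> [hs ha hq hl hc]; have n2 := large_square; split=> //.
- by move=> r r32 r10; rewrite /upd (negbTE r10) hs.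
- by move=> t k t7 kn h; rewrite /upd ifN ?ha //; lia.
- by move=> k; rewrite /upd ifN ?hq // /q_start /log_start; lia.
- move=> i /hl [iB e]; split=> //.
  by rewrite /upd ifN // /log_start; lia.
Qed.

Lemma cell_inj t k t' k' : (k < n * n)%N -> (k' < n * n)%N ->
  (t' * (n * n) + 1 + k' == t * (n * n) + 1 + k)%N = (t' == t) && (k' == k).
Proof.
move=> kn kn'; apply/eqP/andP => [e|[/eqP-> /eqP->]] //.
have {}e : (t' * (n * n) + k' = t * (n * n) + k)%N by lia.
have n0 : (0 < n * n)%N by lia.
have := congr1 (divn^~ (n * n)%N) e; have := congr1 (modn^~ (n * n)%N) e.
by rewrite /= !modnMDl !modn_small // !divnMDl // !divn_small // !addn0 => -> ->.
Qed.

Lemma rep_ar s m t k v : (t < 7)%N -> (k < n * n)%N -> (32 <= t * (n * n) + 1 + k)%N ->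
  rep n B s m -> rep n B (with_ar s (upda (ar s) t k v)) (upd m (t * (n * n) + 1 + k) v).
Proof.
move=> t7 kn tk32 [hs ha hq hl hc]; have n2 := large_square.
have tN : (t * (n * n) <= 6 * (n * n))%N by rewrite leq_mul2r; lia.
split=> //=.
- by move=> r r32 r10; rewrite /upd ifN ?hs //; lia.
- by move=> t' k' t7' kn' h; rewrite /upd /upda cell_inj //; case: ifP => // _; apply: ha.
- by move=> k'; rewrite /upd ifN ?hq // /q_start /log_start; lia.
- move=> i /hl [iB e]; split=> //.
  by rewrite /upd ifN // /log_start; lia.
Qed.

Lemma rep_qm s m k v : rep n B s m ->
  rep n B (Abstract (sc s) (ar s) (upd (qm s) k v) (lg s)) (upd m (q_start n B + k) v).
Proof.
move=> [hs ha hq hl hc]; have n2 := large_square; split=> //=.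
- by move=> r r32 r10; rewrite /upd ifN ?hs // /q_start /log_start; lia.
- move=> t' k' t7 kn' h; rewrite /upd ifN ?ha // /q_start /log_start.
  have tN : (t' * (n * n) <= 6 * (n * n))%N by rewrite leq_mul2r; lia.
  by lia.
- by move=> k'; rewrite /upd eqn_add2l hq.
- move=> i /hl [iB e]; split=> //.
  by rewrite /upd ifN // /q_start; lia.
Qed.

Lemma rep_log s m k v : (size (lg s) < B)%N -> addr v = (q_start n B + k)%N ->
  rep n B s m ->
  rep n B (Abstract (sc s) (ar s) (qm s) (rcons (lg s) k))
    (upd m (log_start n + size (lg s)) v).
Proof.
move=> sB av [hs ha hq hl hc]; have n2 := large_square; split=> //=.
- by move=> r r32 r10; rewrite /upd ifN ?hs // /log_start; lia.
- move=> t' k' t7 kn' h; rewrite /upd ifN ?ha // /log_start.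
  have tN : (t' * (n * n) <= 6 * (n * n))%N by rewrite leq_mul2r; lia.
  by lia.
- by move=> k'; rewrite /upd ifN ?hq // /q_start; lia.
- move=> i; rewrite size_rcons ltnS leq_eqVlt nth_rcons /upd eqn_add2l.
  case/predU1P => [->|si]; first by rewrite ltnn eqxx av.
  by rewrite si ifN; [apply: hl|lia].
Qed.

Lemma rep_drop s m l k : lg s = rcons l k -> rep n B s m ->
  rep n B (Abstract (sc s) (ar s) (qm s) l) m.
Proof.
move=> sl [hs ha hq hl hc]; split=> //= i il.
have := hl i; rewrite sl size_rcons nth_rcons il; apply; lia.
Qed.

End Rep.

(** * Operations on abstract states and their weakest preconditions *)

Inductive op :=
| Oconst of nat & rat
| Oadd of nat & nat & nat
| Osub of nat & nat & nat
| Omul of nat & nat & nat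
| Odiv of nat & nat & nat
| Oload of nat & nat & nat
| Ostore of nat & nat & nat
| Oqload of nat & nat
| Oqstore of nat & nat
| Oqclear.

Definition compile1 (o : op) : seq instr :=
  match o with
  | Oconst d q => [:: IConst d q]
  | Oadd d a b => [:: IAdd d a b]
  | Osub d a b => [:: ISub d a b]
  | Omul d a b => [:: IMul d a b]
  | Odiv d a b => [:: IDiv d a b]
  | Oload d t i => [:: IAdd 10 (20 + t) i; ILoad d 10]
  | Ostore t i a => [:: IAdd 10 (20 + t) i; IStore 10 a]
  | Oqload d a => [:: ILoad d a]
  | Oqstore a b => [:: IStore a b; IStore 4 a; IAdd 4 4 1]
  | Oqclear => [:: ISub 4 4 1; ILoad 7 4; IConst 6 0; IStore 7 6]
  end.

Definition compile (os : seq op) : seq instr := flatten (map compile1 os).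

Definition well_formed1 (o : op) : bool :=
  match o with
  | Oconst d q => writable d
  | Oadd d a b | Osub d a b | Omul d a b | Odiv d a b =>
      [&& writable d, readable a & readable b]
  | Oload d t i => [&& writable d, (t < 7)%N & readable i]
  | Ostore t i a => [&& (t < 7)%N, readable i & readable a]
  | Oqload d a => writable d && readable a
  | Oqstore a b => readable a && readable b
  | Oqclear => true
  end.
Definition well_formed (os : seq op) : bool := all well_formed1 os.

(** Array indices must be naturals in range that avoid the scalars. [Oqstore] writes and logs in one
    operation, so no simulated write escapes the log. In [Oqclear] the popped rational [q] is
    arbitrary, since only its [addr] is known. *)
Fixpoint wp (n B : nat) (os : seq op) (Q : abstract -> Prop) (s : abstract) : Prop :=
  match os with
  | [::] => Q s
  | o :: r => match o with
    | Oconst d q => wp n B r Q (with_sc s (upd (sc s) d q))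
    | Oadd d a b => wp n B r Q (with_sc s (upd (sc s) d (sc s a + sc s b)))
    | Osub d a b => wp n B r Q (with_sc s (upd (sc s) d (sc s a - sc s b)))
    | Omul d a b => wp n B r Q (with_sc s (upd (sc s) d (sc s a * sc s b)))
    | Odiv d a b => wp n B r Q (with_sc s (upd (sc s) d (sc s a / sc s b)))
    | Oload d t i => exists k,
       [/\ sc s i = k%:R, (k < n * n)%N, (32 <= t * (n * n) + 1 + k)%N &
           wp n B r Q (with_sc s (upd (sc s) d (ar s t k)))]
    | Ostore t i a => exists k,
       [/\ sc s i = k%:R, (k < n * n)%N, (32 <= t * (n * n) + 1 + k)%N &
           wp n B r Q (with_ar s (upda (ar s) t k (sc s a)))]
    | Oqload d a => exists k, addr (sc s a) = (q_start n B + k)%N /\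
           wp n B r Q (with_sc s (upd (sc s) d (qm s k)))
    | Oqstore a b => exists k,
       [/\ addr (sc s a) = (q_start n B + k)%N, (size (lg s) < B)%N,
           sc s 4 = (log_start n + size (lg s))%:R &
           wp n B r Q (Abstract (upd (sc s) 4 (sc s 4 + 1)) (ar s)
             (upd (qm s) k (sc s b)) (rcons (lg s) k))]
    | Oqclear => exists l k,
       [/\ lg s = rcons l k, sc s 4 = (log_start n + size (lg s))%:R &
           forall q, wp n B r Q (Abstract
             (upd (upd (upd (sc s) 4 (log_start n + size l)%:R) 7 q) 6 0)
             (ar s) (upd (qm s) k 0) l)]
    end
  end.

Section Soundness.
Variables (n B : nat).
Hypothesis n32 : (32 <= n)%N.

Lemma rep_read s m r : readable r -> rep n B s m -> m r = sc s r.
Proof. by case/andP=> r32 r10 [hs _ _ _ _]; apply: hs. Qed.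

Lemma upd_same m d v : upd m d v d = v.
Proof. by rewrite /upd eqxx. Qed.

Lemma upd_other m d v e : e != d -> upd m d v e = m e.
Proof. by rewrite /upd => /negbTE ->. Qed.

Lemma rep_cell s m t i k : (t < 7)%N -> readable i -> rep n B s m -> sc s i = k%:R ->
  addr (m (20 + t)%N + m i) = (t * (n * n) + 1 + k)%N.
Proof.
move=> t7 ri rm si; rewrite !(rep_read _ rm) //; last by rewrite /readable; lia.
case: rm => _ _ _ _ [_ _ _ _ [_ ct]].
by rewrite ct // si -natrD addr_nat.
Qed.

Lemma rep_constants s m : rep n B s m -> constants n B (sc s).
Proof. by case. Qed.

Lemma wp_sound os Q s m : well_formed os -> rep n B s m -> wp n B os Q s ->
  exists2 s', rep n B s' (foldl eval1 m (compile os)) & Q s'.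
Proof.
elim: os s m => [|o os IH] s m /=; first by move=> _ rm qs; exists s.
case/andP=> wo wos rm; rewrite /compile /= foldl_cat -/(compile os).
case: o wo => [d q|d a b|d a b|d a b|d a b|d t i|t i a|d a|a b|] /=.
- by move=> wd; apply: IH => //; apply: rep_sc.
- move=> /and3P [wd ra rb]; apply: IH => //.
  by rewrite (rep_read ra rm) (rep_read rb rm); apply: rep_sc.
- move=> /and3P [wd ra rb]; apply: IH => //.
  by rewrite (rep_read ra rm) (rep_read rb rm); apply: rep_sc.
- move=> /and3P [wd ra rb]; apply: IH => //.
  by rewrite (rep_read ra rm) (rep_read rb rm); apply: rep_sc.
- move=> /and3P [wd ra rb]; apply: IH => //.
  by rewrite (rep_read ra rm) (rep_read rb rm); apply: rep_sc.
- move=> /and3P [wd t7 ri] [k [si kn h32]]; apply: IH => //.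
  rewrite upd_same (rep_cell t7 ri rm si) upd_other; last by lia.
  case: (rm) => _ ha _ _ _; rewrite ha //.
  by apply: rep_sc => //; apply: rep_scratch.
- move=> /and3P [t7 ri ra] [k [si kn h32]]; apply: IH => //.
  rewrite upd_same (rep_cell t7 ri rm si) upd_other; last by case/andP: ra.
  by rewrite (rep_read ra rm); apply: rep_ar => //; apply: rep_scratch.
- move=> /andP [wd ra] [k [sa]]; apply: IH => //.
  rewrite (rep_read ra rm) sa.
  by case: (rm) => _ _ hq _ _; rewrite hq; apply: rep_sc.
- move=> /andP [ra rb] [k [sa sB s4]]; apply: IH => //.
  have n2 : (32 <= q_start n B + k)%N by rewrite /q_start /log_start; nia.
  have [a32 a10] := andP ra.
  rewrite (rep_read ra rm) (rep_read rb rm) sa.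
  have r1 := rep_qm n32 k (sc s b) rm.
  rewrite (rep_read (isT : readable 4) r1) (rep_read ra r1) /= s4 addr_nat.
  have r2 := rep_log n32 (s := Abstract _ _ _ (lg s)) sB sa r1.
  rewrite (rep_read (isT : readable 4) r2) (rep_read (isT : readable 1) r2) /=.
  have [_ c1 _ _ _] := rep_constants rm.
  by rewrite s4 c1; apply: (rep_sc (d := 4) n32 _ _ r2).
move=> _ [l [k [sl s4 qs]]].
have [_ c1 _ _ _] := rep_constants rm.
rewrite (rep_read (isT : readable 4) rm) (rep_read (isT : readable 1) rm).
rewrite s4 c1 sl size_rcons addnS -natr1 addrK.
have r1 := rep_sc (d := 4) n32 ((log_start n + size l)%:R) isT rm.
rewrite (rep_read (isT : readable 4) r1) /= upd_same addr_nat.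
set v := upd m 4 _ _.
have av : addr v = (q_start n B + k)%N.
  case: (r1) => _ _ _ hl _; have [|_ ->] /= := hl (size l).
    by rewrite sl size_rcons.
  by rewrite sl nth_rcons ltnn eqxx.
have r2 := rep_sc (d := 7) n32 v isT r1.
have r3 := rep_sc (d := 6) n32 0 isT r2.
rewrite (rep_read (isT : readable 7) r3) (rep_read (isT : readable 6) r3) /= av.
apply: (IH _ _ wos _ (qs v)).
exact: (rep_drop (s := Abstract _ _ _ (lg s)) n32 sl (rep_qm n32 k 0 r3)).
Qed.

(** Total correctness with a time bound, independent of where the code is placed. The precondition
    is one fixed state [s], so that [Q] can compare the final state with it. *)
Record triple (c : code) (t : nat) (s : abstract) (Q : abstract -> Prop) : Prop :=
  Triple { tripleP : forall P b m, placed P b (c b) -> rep n B s m ->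
    exists T m' s', [/\ (T <= t)%N,
      run P T (State b m) = State (b + size (c b)) m', rep n B s' m' & Q s'] }.

Lemma triple_weaken c t t' s (Q Q' : abstract -> Prop) : (t <= t')%N ->
  (forall s, Q s -> Q' s) -> triple c t s Q -> triple c t' s Q'.
Proof.
move=> tt qq [h]; split=> P b m pl /(h _ _ _ pl) [T [m' [s' [Tb e r q]]]].
by exists T, m', s'; split=> //; [apply: leq_trans tt|apply: qq].
Qed.

Lemma triple_seq c1 c2 t1 t2 s Q R : triple c1 t1 s Q ->
  (forall s', Q s' -> triple c2 t2 s' R) -> triple (cseq c1 c2) (t1 + t2) s R.
Proof.
move=> [h1] h2; split=> P b m /placed_cat [p1 p2] rm.
have [T1 [m1 [s1 [Tb1 e1 r1 q1]]]] := h1 _ _ _ p1 rm.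
have [T2 [m2 [s2 [Tb2 e2 r2 q2]]]] := tripleP (h2 _ q1) p2 r1.
exists (T1 + T2)%N, m2, s2; split=> //; first exact: leq_add.
by rewrite runD e1 e2 size_cat addnA.
Qed.

Lemma straight_compile os : all straight (compile os).
Proof.
elim: os => //= o os IH.
by rewrite /compile /= all_cat -/(compile os) IH andbT; case: o.
Qed.

Lemma triple_ops os s t Q : well_formed os -> (size (compile os) <= t)%N ->
  wp n B os Q s -> triple (fun=> compile os) t s Q.
Proof.
move=> wos st ws; split=> P b m pl rm; have [s' r q] := wp_sound wos rm ws.
exists (size (compile os)), (foldl eval1 m (compile os)), s'; split=> //.
exact: run_straight (straight_compile os) pl.
Qed.

(** The index of [I] is the number of iterations left. Each costs 2 steps beyond the body (test and
    jump back), and the last test costs 1. *)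
Lemma triple_while r body t (I : nat -> abstract -> Prop) j s : readable r ->
  (forall j s, I j s -> (sc s r == 0) = (j == 0%N)) ->
  (forall j s, I j.+1 s -> triple body t s (I j)) ->
  I j s -> triple (cwhile r body) (j * (t + 2) + 1) s (I 0%N).
Proof.
move=> rr hr hb Is; split=> P b m pl; elim: j s m Is => [|j IH] s m Is rm; have := hr _ _ Is.
  move=> /eqP s0; exists 1%N, m, s; split=> //.
  by apply: run_while_stop pl _; rewrite (rep_read rr rm).
move=> /negbT s0; have [_ /placed_cat [pb _]] := placed_cons pl.
have [T1 [m1 [s1 [Tb1 e1 r1 q1]]]] := tripleP (hb _ _ Is) pb rm.
have [T2 [m2 [s2 [Tb2 e2 r2 q2]]]] := IH _ _ q1 r1.
exists (T1 + 2 + T2)%N, m2, s2; split=> //; first by lia.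
by rewrite runD (run_while_step pl _ e1) // (rep_read rr rm).
Qed.

Lemma wp_cat o1 o2 Q s : wp n B o1 (wp n B o2 Q) s -> wp n B (o1 ++ o2) Q s.
Proof.
elim: o1 s => //= -[d q|d a b|d a b|d a b|d a b|d t i|t i a|d a|a b|] os IH s; try exact: IH.
- by move=> [k [h1 h2 h3 /IH h4]]; exists k.
- by move=> [k [h1 h2 h3 /IH h4]]; exists k.
- by move=> [k [h1 /IH h4]]; exists k.
- by move=> [k [h1 h2 h3 /IH h4]]; exists k.
- by move=> [l [k [h1 h2 h3]]]; exists l, k; split=> // q; apply: IH.
Qed.

Lemma wp_mono os (Q Q' : abstract -> Prop) s : (forall s, Q s -> Q' s) ->
  wp n B os Q s -> wp n B os Q' s.
Proof.
move=> qq.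
elim: os s => [|[d q|d a b|d a b|d a b|d a b|d t i|t i a|d a|a b|] os IH] s /=; try exact: IH; try exact: qq.
- by move=> [k [h1 h2 h3 /IH h4]]; exists k.
- by move=> [k [h1 h2 h3 /IH h4]]; exists k.
- by move=> [k [h1 /IH h4]]; exists k.
- by move=> [k [h1 h2 h3 /IH h4]]; exists k.
- by move=> [l [k [h1 h2 h3]]]; exists l, k; split=> // q; apply: IH.
Qed.

End Soundness.
Section Simulation.
Variables (n B : nat).
Hypothesis n32 : (32 <= n)%N.

Lemma triple_constants c b s Q : triple n B c b s Q ->
  triple n B c b s (fun s' => Q s' /\ constants n B (sc s')).
Proof.
move=> [h]; split=> P i m pl /(h _ _ _ pl) [T [m' [s' [Tb e r q]]]]; exists T, m', s'; split=> //.
by split=> //; apply: rep_constants r.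
Qed.

Lemma triple_given_constants c b s Q :
  (constants n B (sc s) -> triple n B c b s Q) -> triple n B c b s Q.
Proof. by move=> h; split=> P i m pl rm; apply: (tripleP (h (rep_constants rm)) pl rm). Qed.

(** Loops test for zero only, so register 9 keeps the difference between the bound in register [r]
    and the index in register 8. The caller sets the initial index, which allows loops that skip
    leading cells. *)
Definition cfor (r : nat) (body : seq op) : code :=
  cseq (fun=> compile [:: Osub 9 r 8])
    (cwhile 9 (cseq (fun=> compile body) (fun=> compile [:: Oadd 8 8 1; Osub 9 r 8]))).

Lemma triple_for r body s E i0 (I : nat -> abstract -> Prop) :
  readable r -> r != 8 -> well_formed body -> (i0 <= E)%N ->
  (forall x, constants n B x -> x r = E%:R) ->
  (forall i s d y, (d == 8)%N || (d == 9)%N -> I i s -> I i (with_sc s (upd (sc s) d y))) ->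
  (forall i s, (i < E)%N -> constants n B (sc s) -> sc s 8 = i%:R -> I i s ->
     wp n B body (fun s' => sc s' 8 = i%:R /\ I i.+1 s') s) ->
  sc s 8 = i0%:R -> I i0 s ->
  triple n B (cfor r body) (1 + ((E - i0) * (size (compile body) + 4) + 1)) s
    (fun s' => sc s' 8 = E%:R /\ I E s').
Proof.
move=> rr r8 wb iE rE stab hb s8 Is.
(* The number of remaining iterations [j] corresponds to the index [E - j]. *)
pose J j s := [/\ sc s 9 = j%:R, (j <= E)%N, sc s 8 = (E - j)%:R & I (E - j)%N s].
apply: triple_seq (_ : triple n B _ _ _ (J (E - i0)%N)) _.
  apply: triple_given_constants => cs.
  apply: (triple_ops n32 (os := [:: Osub 9 r 8])) => //=; first by rewrite rr.
  rewrite /J /= subKn // s8 rE //; split=> //.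
  - by rewrite upd_same natrB.
  - by lia.
  - by apply: stab.
move=> s' Js'.
apply: triple_weaken (triple_while (r := 9) (I := J)
  (t := (size (compile body) + 2)%N) n32 isT _ _ Js').
- by rewrite -addnA.
- by move=> s1 [_ _]; rewrite subn0 => -> ?.
- by move=> j s1 [-> _ _ _]; rewrite pnatr_eq0.
move=> j s1 [_ jE s18 I1].
apply: (triple_seq (t1 := size (compile body)) (t2 := 2)
  (Q := fun s' => (sc s' 8 = (E - j.+1)%:R /\ I (E - j)%N s') /\ constants n B (sc s'))).
  apply/triple_constants/triple_given_constants => cs; apply: triple_ops => //.
  by have := hb (E - j.+1)%N s1; rewrite -subSn ?subSS //; apply=> //; lia.
move=> s2 [[s28 I2] cs2].
apply: (triple_ops n32 (os := [:: Oadd 8 8 1; Osub 9 r 8])) => //=.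
  by rewrite rr.
have [_ c1 _ _ _] := cs2.
have e : (E - j)%:R = (E - j.+1)%:R + 1 :> rat by rewrite natr1; congr _%:R; lia.
rewrite /J; split=> /=.
- rewrite /upd /= (negbTE r8) rE // s28 c1 -e natrB; last by lia.
  by ring.
- by lia.
- by rewrite /upd /= s28 c1.
- by do 2!apply: (stab _ _) => //.
Qed.
End Simulation.
(** * Simulating the multiplication program *)

Definition shift_address (r : nat) : code :=
  fun b => [:: IJlt r (b + 3); IAdd r r 3; IJmp (b + 4); ISub r r 3].

Definition q_address (r a : nat) := [:: Oconst r a%:R; Oadd r r 3].
Definition q_read (r a : nat) := q_address r a ++ [:: Oqload r r].
Definition q_write (d v : nat) := q_address 7 d ++ [:: Oqstore 7 v].

(** Direct operands have addresses known at compile time; only [ILoad] and [IStore] meet addresses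
    computed by [Q], whose sign decides the direction of the shift. For a branch, the body just
    fetches the tested value into register 5. *)
Definition sim_body (i : instr) : code :=
  match i with
  | IConst d q => fun=> compile (Oconst 5 q :: q_write d 5)
  | IAdd d a b => fun=> compile (q_read 5 a ++ q_read 6 b ++ Oadd 5 5 6 :: q_write d 5)
  | ISub d a b => fun=> compile (q_read 5 a ++ q_read 6 b ++ Osub 5 5 6 :: q_write d 5)
  | IMul d a b => fun=> compile (q_read 5 a ++ q_read 6 b ++ Omul 5 5 6 :: q_write d 5)
  | IDiv d a b => fun=> compile (q_read 5 a ++ q_read 6 b ++ Odiv 5 5 6 :: q_write d 5)
  | ILoad d a => cseq (fun=> compile (q_read 5 a))
      (cseq (shift_address 5) (fun=> compile (Oqload 5 5 :: q_write d 5)))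
  | IStore a b => cseq (fun=> compile (q_read 7 a))
      (cseq (shift_address 7) (fun=> compile (q_read 5 b ++ [:: Oqstore 7 5])))
  | IJz a _ | IJlt a _ => fun=> compile (q_read 5 a)
  | IJmp _ | IHalt => fun=> compile [::]
  end.

Definition sim_jump (label : nat -> nat) (next exit : nat) (i : instr) : seq instr :=
  match i with
  | IJz _ l => [:: IJz 5 (label l); IJmp next]
  | IJlt _ l => [:: IJlt 5 (label l); IJmp next]
  | IJmp l => [:: IJmp (label l)]
  | IHalt => [:: IJmp exit]
  | _ => [:: IJmp next]
  end.

Lemma size_sim_body i b : (size (sim_body i b) <= 13)%N.
Proof. by case: i. Qed.

Lemma size_sim_jump f x e i : (size (sim_jump f x e i) <= 2)%N.
Proof. by case: i. Qed.

(* All blocks have 16 instructions, so that the label of instruction p is an affine function of p. *)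
Definition sim_block (label : nat -> nat) (next exit : nat) (i : instr) : code :=
  fun b => let c := sim_body i b ++ sim_jump label next exit i in
    c ++ nseq (16 - size c) IHalt.

Lemma size_sim_block f x e i b : size (sim_block f x e i b) = 16.
Proof.
rewrite /sim_block size_cat size_nseq subnKC // size_cat.
by have := size_sim_body i b; have := size_sim_jump f x e i; lia.
Qed.

(** Every label at or beyond [size Q] means a halt, as [nth] defaults to [IHalt]; all of them are
    sent to the end of the simulating code. *)
Definition sim_label (Q : program) (b p : nat) := (b + 16 * minn p (size Q))%N.

Definition simulate (Q : program) : code := fun b =>
  flatten [seq sim_block (sim_label Q b) (sim_label Q b p.+1) (sim_label Q b (size Q))
    (nth IHalt Q p) (sim_label Q b p) | p <- iota 0 (size Q)].

Lemma placed_flatten P b w (f : nat -> seq instr) q k :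
  (forall p, size (f p) = w) -> placed P b (flatten [seq f p | p <- iota q k]) ->
  forall p, (q <= p < q + k)%N -> placed P (b + w * (p - q)) (f p).
Proof.
move=> fw; elim: k q b => [|k IH] q b /=; first by move=> _ p; lia.
case/placed_cat=> p1 p2 p /andP [].
rewrite leq_eqVlt => /predU1P [<- _|qp pk]; first by rewrite subnn muln0 addn0.
rewrite fw in p2; have := IH _ _ p2 p; rewrite qp addSnnS pk => /(_ isT).
by rewrite -addnA -mulnS subnSK.
Qed.

Lemma size_simulate Q b : size (simulate Q b) = (16 * size Q)%N.
Proof.
rewrite /simulate size_flatten /shape -map_comp sumnE big_map.
rewrite (eq_bigr (fun=> 16%N)) => [|p _]; last exact: size_sim_block.
by rewrite big_const_seq count_predT size_iota iter_addn_0.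
Qed.

Section Simulation.
Variables (n B : nat).
Hypothesis n32 : (32 <= n)%N.

Lemma triple_shift_address r s : writable r ->
  triple n B (shift_address r) 3 s (fun s' => s' = with_sc s (upd (sc s) r
    (if sc s r < 0 then sc s r - (q_start n B)%:R else sc s r + (q_start n B)%:R))).
Proof.
move=> wr; split=> P b m pl rm; have [_ _ _ c3 _] := rep_constants rm.
have rr : readable r by move: wr; rewrite /writable /readable !inE; lia.
set v := if _ then _ else _; set s' := with_sc s _.
exists (if sc s r < 0 then 2%N else 3%N), (upd m r v), s'.
split=> //; [by case: ifP| |exact: rep_sc].
rewrite /v -c3 -!(rep_read _ rm) //.
move: pl => /placed_cons [h0 /placed_cons [h1 /placed_cons [h2 /placed_cons [h3 _]]]].
rewrite /=; case: ifP => s0.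
  by rewrite !run_step /step /= h0 /= s0 addn3 h3 /run /= addnS addn3.
by rewrite !run_step /step /= h0 /= s0 h1 /= h2.
Qed.

(** That the log contains the support of the simulated memory is what later allows [Q]'s writes to
    be undone. Scalars from 12 on survive the simulation and carry the state of the main
    algorithm. *)
Definition simulates (s0 s : abstract) (mq : memory) : Prop :=
  [/\ qm s =1 mq, forall k, mq k != 0 -> k \in lg s,
      sc s 4 = (log_start n + size (lg s))%:R, ar s = ar s0 &
      forall r, (12 <= r)%N -> sc s r = sc s0 r].

Definition sim_post (s0 s : abstract) (i : instr) (mq : memory) (s' : abstract) : Prop :=
  [/\ simulates s0 s' (eval1 mq i), (size (lg s') <= (size (lg s)).+1)%N &
      match i with IJz a _ | IJlt a _ => sc s' 5 = mq a | _ => True end].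

Lemma q_address_value (a : nat) (r : nat -> rat) : constants n B r ->
  addr (a%:R + r 3%N) = (q_start n B + a)%N.
Proof. by case=> _ _ _ -> _; rewrite -natrD addr_nat addnC. Qed.

Lemma wp_q_read (r a : nat) Q s : writable r -> constants n B (sc s) ->
  Q (with_sc s (upd (upd (upd (sc s) r a%:R) r (a%:R + sc s 3)) r (qm s a))) ->
  wp n B (q_read r a) Q s.
Proof.
move=> wr cs q; have r3 : 3%N != r by apply: contraTneq wr => <-.
rewrite /= (upd_same (sc s) r) (upd_other (sc s) _ r3).
by exists a; rewrite upd_same q_address_value.
Qed.

Lemma wp_q_store (s0 : abstract) (k v : nat) mq s : constants n B (sc s) ->
  addr (sc s 7) = (q_start n B + k)%N ->
  (size (lg s) < B)%N -> simulates s0 s mq ->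
  wp n B [:: Oqstore 7 v]
    (fun s' => [/\ simulates s0 s' (upd mq k (sc s v)), size (lg s') = (size (lg s)).+1 &
      forall r, r != 4%N -> sc s' r = sc s r]) s.
Proof.
move=> cs a7 sB [h1 h2 h3 h4 h5].
exists k; rewrite a7; split=> //; split=> /=; first split=> //=.
- by move=> j; rewrite /upd h1.
- by move=> j; rewrite /upd mem_rcons inE; case: (j =P k) => //= _; apply: h2.
- by rewrite upd_same h3 size_rcons addnS -natr1.
- by move=> r r12; rewrite upd_other ?h5 //; lia.
- by rewrite size_rcons.
- by move=> r r4; rewrite upd_other.
Qed.

Lemma simulates_sc s0 s mq x : (forall r, (12 <= r)%N -> x r = sc s r) ->
  x 4%N = sc s 4 -> simulates s0 s mq -> simulates s0 (with_sc s x) mq.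
Proof.
move=> hx x4 [h1 h2 h3 h4 h5]; split=> //=; first by rewrite x4.
by move=> r r12; rewrite hx ?h5.
Qed.

Lemma upd_high (x y : nat -> rat) d v : (d < 12)%N ->
  (forall r, (12 <= r)%N -> x r = y r) -> forall r, (12 <= r)%N -> upd x d v r = y r.
Proof. by move=> d12 h r r12; rewrite upd_other ?h //; lia. Qed.

Lemma wp_q_write (s0 : abstract) (d v : nat) mq s : (v < 7)%N -> constants n B (sc s) ->
  (size (lg s) < B)%N -> simulates s0 s mq ->
  wp n B (q_write d v)
    (fun s' => [/\ simulates s0 s' (upd mq d (sc s v)), size (lg s') = (size (lg s)).+1 &
      forall r, (8 <= r)%N -> sc s' r = sc s r]) s.
Proof.
move=> v7 cs sB sim.
pose s1 := with_sc s (upd (upd (sc s) 7 d%:R) 7 (d%:R + sc s 3)).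
suff: wp n B [:: Oqstore 7 v] (fun s' => [/\ simulates s0 s' (upd mq d (sc s v)),
  size (lg s') = (size (lg s)).+1 & forall r, (8 <= r)%N -> sc s' r = sc s r]) s1 by [].
apply: wp_mono (wp_q_store (s0 := s0) (k := d) (mq := mq) v _ _ _ _) => //.
- move=> s' [h1 h2 h3]; split=> //; first by move: h1; rewrite /= !upd_other ?ltn_eqF.
  by move=> r r8; rewrite h3 /= ?upd_other //; lia.
- by rewrite /= upd_same q_address_value.
- by apply: simulates_sc sim => //; do !apply: upd_high.
Qed.

Definition is_branch (i : instr) : bool :=
  match i with IJz _ _ | IJlt _ _ => true | _ => false end.

Lemma wp_sim_write (s0 : abstract) (d : nat) mq s s1 i q : constants n B (sc s1) ->
  (size (lg s1) < B)%N -> simulates s0 s1 mq -> size (lg s1) = size (lg s) ->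
  sc s1 5 = q -> eval1 mq i = upd mq d q -> ~~ is_branch i ->
  wp n B (q_write d 5) (sim_post s0 s i mq) s1.
Proof.
move=> cs sB sim ss s5 ei ni; apply: wp_mono (wp_q_write d _ _ _ sim) => //.
move=> s' [h1 h2 _]; split; first by rewrite ei -s5.
  by rewrite h2 ss.
by case: i ni {ei}.
Qed.

Lemma sim_body_sound s0 s i mq : (size (lg s) < B)%N -> simulates s0 s mq ->
  triple n B (sim_body i) 13 s (sim_post s0 s i mq).
Proof.
move=> sB sim; apply: triple_given_constants => cs; have [hq _ _ _ _] := sim.
have keep x : (forall r, (12 <= r)%N -> x r = sc s r) -> x 4%N = sc s 4 ->
    simulates s0 (with_sc s x) mq by move=> h1 h2; apply: simulates_sc sim.
case: i => [d q|d a b|d a b|d a b|d a b|d a|a b|a l|a l|l|].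
- apply: triple_ops => //.
  by apply: (wp_sim_write (s1 := with_sc s _)) => //; apply: keep => //; do !apply: upd_high.
- apply: triple_ops => //.
  apply/wp_cat/wp_q_read => //; apply/wp_cat/wp_q_read => //.
  apply: (wp_sim_write (s1 := with_sc _ _)) => //; last by rewrite /= /upd /= !hq.
  by apply: keep => //; do !apply: upd_high.
- apply: triple_ops => //.
  apply/wp_cat/wp_q_read => //; apply/wp_cat/wp_q_read => //.
  apply: (wp_sim_write (s1 := with_sc _ _)) => //; last by rewrite /= /upd /= !hq.
  by apply: keep => //; do !apply: upd_high.
- apply: triple_ops => //.
  apply/wp_cat/wp_q_read => //; apply/wp_cat/wp_q_read => //.
  apply: (wp_sim_write (s1 := with_sc _ _)) => //; last by rewrite /= /upd /= !hq.
  by apply: keep => //; do !apply: upd_high.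
- apply: triple_ops => //.
  apply/wp_cat/wp_q_read => //; apply/wp_cat/wp_q_read => //.
  apply: (wp_sim_write (s1 := with_sc _ _)) => //; last by rewrite /= /upd /= !hq.
  by apply: keep => //; do !apply: upd_high.
- apply: (triple_seq (t1 := 3) (t2 := 10) (Q := eq (with_sc s
    (upd (upd (upd (sc s) 5 a%:R) 5 (a%:R + sc s 3)) 5 (qm s a))))).
    by apply: triple_ops => //; apply: wp_q_read.
  move=> _ <-; apply: (triple_seq (t1 := 3) (t2 := 7)).
    by apply: triple_shift_address.
  move=> _ ->; apply: triple_ops => //.
  (* By [addr_shift], the shifted pointer designates the cell [addr (mq a)] of the simulated
     memory. *)
  exists (addr (mq a)); split; first by rewrite /= upd_same addr_shift upd_same hq.
  apply: (wp_sim_write (s1 := with_sc _ _)) => //; last by rewrite /= upd_same hq.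
  by apply: keep => //; do !apply: upd_high.
- apply: (triple_seq (t1 := 3) (t2 := 10) (Q := eq (with_sc s
    (upd (upd (upd (sc s) 7 a%:R) 7 (a%:R + sc s 3)) 7 (qm s a))))).
    by apply: triple_ops => //; apply: wp_q_read.
  move=> _ <-; apply: (triple_seq (t1 := 3) (t2 := 7)).
    by apply: triple_shift_address.
  move=> _ ->; apply: triple_ops => //.
  apply/wp_cat/wp_q_read => //.
  apply: wp_mono (wp_q_store (s0 := s0) (k := addr (mq a)) (mq := mq) 5 _ _ _ _) => //.
  + move=> s' [h1 h2 _]; split=> //; last by rewrite h2.
    by move: h1; rewrite /= upd_same /= hq.
  + by rewrite /= /upd /= addr_shift hq.
  + by apply: keep => //; do !apply: upd_high.
- apply: triple_ops => //; apply: wp_q_read => //; split=> //.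
    by apply: keep => //; do !apply: upd_high.
  by rewrite /= upd_same.
- apply: triple_ops => //; apply: wp_q_read => //; split=> //.
    by apply: keep => //; do !apply: upd_high.
  by rewrite /= upd_same.
- by apply: triple_ops.
- by apply: triple_ops.
Qed.

Lemma placed_sim_block Q b P p : placed P b (simulate Q b) -> (p < size Q)%N ->
  placed P (sim_label Q b p)
    (sim_block (sim_label Q b) (sim_label Q b p.+1) (sim_label Q b (size Q))
       (nth IHalt Q p) (sim_label Q b p)).
Proof.
move=> pl pQ; rewrite {1}/sim_label (minn_idPl (ltnW pQ)) -{1}[p]subn0.
by apply: (placed_flatten _ pl) => // i; apply: size_sim_block.
Qed.

Lemma halted_run Q T st : halted Q st -> run Q T st = st.
Proof.
move=> h; elim: T => // T IH; rewrite run_step -[RHS]IH; congr run.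
by rewrite /step; move: h; rewrite /halted; case: nth => //; case: st {IH}.
Qed.

(** An explicit [IHalt] costs one jump to the exit; when [Q] has left its own text, the label
    already is the exit. *)
Lemma simulate_halted Q P b st m : placed P b (simulate Q b) -> halted Q st ->
  exists2 T, (T <= 1)%N &
    run P T (State (sim_label Q b (pc st)) m) = State (b + size (simulate Q b)) m.
Proof.
move=> pl h; case: (ltnP (pc st) (size Q)) => hQ; last first.
  by exists 0%N => //; rewrite /run /= /sim_label size_simulate (minn_idPr hQ).
exists 1%N => //; have := placed_sim_block pl hQ; move: h; rewrite /halted.
case: nth => // _ /placed_cons [hj _].
rewrite /run /= /step /= hj /=; congr State.
by rewrite /sim_label size_simulate minnn.
Qed.

Lemma regs_step Q st : regs (step Q st) = eval1 (regs st) (nth IHalt Q (pc st)).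
Proof. by rewrite /step; case: nth. Qed.

Lemma run_sim_jump Q P b b' x st m :
  placed P b (sim_jump (sim_label Q b') (sim_label Q b' (pc st).+1) x (nth IHalt Q (pc st))) ->
  ~~ halted Q st ->
  match nth IHalt Q (pc st) with IJz a _ | IJlt a _ => m 5%N = regs st a | _ => True end ->
  exists2 T, (T <= 2)%N &
    run P T (State b m) = State (sim_label Q b' (pc (step Q st))) m.
Proof.
rewrite /halted /step.
case: (nth IHalt Q (pc st)) => [d q|d a1 b1|d a1 b1|d a1 b1|d a1 b1|d a|a b1|a l|a l|l|] //=
  /placed_cons [j1 p2] _ m5;
  try by exists 1%N => //; rewrite /run /= /step /= j1.
- move/placed_cons: p2 => [j2 _]; rewrite -m5; case: ifP => m0.
    by exists 1%N => //; rewrite /run /= /step /= j1 m0.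
  by exists 2%N => //; rewrite !run_step /run /= /step /= j1 m0 /= j2.
- move/placed_cons: p2 => [j2 _]; rewrite -m5; case: ifP => m0.
    by exists 1%N => //; rewrite /run /= /step /= j1 m0.
  by exists 2%N => //; rewrite !run_step /run /= /step /= j1 m0 /= j2.
Qed.

(** A block takes at most 13 steps for the body and 2 for the jump, and adds at most one log
    entry. *)
Lemma simulate_step Q P b s0 st s m : placed P b (simulate Q b) ->
  rep n B s m -> simulates s0 s (regs st) -> (size (lg s) < B)%N -> ~~ halted Q st ->
  exists T m' s', [/\ (T <= 15)%N,
    run P T (State (sim_label Q b (pc st)) m) = State (sim_label Q b (pc (step Q st))) m',
    rep n B s' m', simulates s0 s' (regs (step Q st)) & (size (lg s') <= (size (lg s)).+1)%N].
Proof.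
move=> pl rm sim sB hst; case: (ltnP (pc st) (size Q)) => hQ; last first.
  by move: hst; rewrite /halted nth_default.
have /placed_cat [/placed_cat [p1 p2] _] := placed_sim_block pl hQ.
have [T1 [m1 [s1 [Tb e r1 [sim1 sz br]]]]] :=
  tripleP (sim_body_sound (nth IHalt Q (pc st)) sB sim) p1 rm.
have [|T2 T2b e2] := run_sim_jump (m := m1) p2 hst.
  by rewrite (rep_read (isT : readable 5) r1); move: br; case: nth.
exists (T1 + T2)%N, m1, s1; split=> //; first by lia.
- by rewrite runD e e2.
- by rewrite regs_step.
Qed.

Lemma simulate_run Q P b s0 T st s m : placed P b (simulate Q b) ->
  rep n B s m -> simulates s0 s (regs st) -> (size (lg s) + T <= B)%N ->
  halted Q (run Q T st) ->
  exists T' m' s', [/\ (T' <= 15 * T + 1)%N,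
    run P T' (State (sim_label Q b (pc st)) m) = State (b + size (simulate Q b)) m',
    rep n B s' m', simulates s0 s' (regs (run Q T st)) & (size (lg s') <= size (lg s) + T)%N].
Proof.
move=> pl; elim: T st s m => [|T IH] st s m rm sim sB h.
  have [T Tb e] := simulate_halted m pl h.
  by exists T, m, s; split=> //; rewrite addn0.
case: (boolP (halted Q st)) => [h0|h0].
  have [T' Tb e] := simulate_halted m pl h0.
  by exists T', m, s; rewrite (halted_run T.+1 h0); split=> //; lia.
have [|T1 [m1 [s1 [T1b e1 r1 sim1 sz1]]]] := simulate_step pl rm sim _ h0; first by lia.
rewrite run_step in h *.
have [|T2 [m2 [s2 [T2b e2 r2 sim2 sz2]]]] := IH _ _ _ r1 sim1 _ h; first by lia.
exists (T1 + T2)%N, m2, s2; split=> //; first by lia.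
- by rewrite runD e1.
- by lia.
Qed.

Lemma triple_simulate Q s0 s T mq : simulates s0 s mq -> (size (lg s) + T <= B)%N ->
  halted Q (run Q T (State 0 mq)) ->
  triple n B (simulate Q) (15 * T + 1) s (fun s' =>
    simulates s0 s' (regs (run Q T (State 0 mq))) /\ (size (lg s') <= size (lg s) + T)%N).
Proof.
move=> sim sB h; split=> P b m pl rm.
have [T' [m' [s' [T'b e r' sim' sz]]]] := simulate_run pl rm (st := State 0 mq) sim sB h.
exists T', m', s'; split=> //.
by move: e; rewrite /sim_label /= min0n muln0 addn0.
Qed.

End Simulation.
(** * One matrix product *)

Definition matrix_of (n : nat) (f : nat -> rat) : 'M[rat]_n :=
  \matrix_(i, j) f (i * n + j)%N.

(** The input memory of [Q] when [i] entries of the left and [j] entries of the right factor have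
    been copied; for [i = j = n * n] it is [mm_input]. *)
Definition product_memory (n : nat) (f g : nat -> rat) (i j : nat) : memory := fun k =>
  if k == 0%N then n%:R else if (k.-1 < i)%N then f k.-1 else
  if (n * n <= k.-1 < n * n + j)%N then g (k.-1 - n * n)%N else 0.

Lemma flat_lt n (i j : 'I_n) : (i * n + j < n * n)%N.
Proof. by have := ltn_ord i; have := ltn_ord j; nia. Qed.

Lemma flat_split n k : (k < n * n)%N -> exists i j : 'I_n, k = (i * n + j)%N.
Proof.
move=> kn; have n0 : (0 < n)%N by case: n kn.
have hi : (k %/ n < n)%N by rewrite ltn_divLR.
by exists (Ordinal hi), (Ordinal (ltn_pmod k n0)); rewrite /= -divn_eq.
Qed.

Lemma flat_inj n (i j i' j' : 'I_n) :
  (i * n + j == i' * n + j')%N = ((i, j) == (i', j')).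
Proof.
apply/eqP/eqP => [e|[-> ->]] //.
have n0 : (0 < n)%N by apply: leq_trans (ltn_ord i).
have := congr1 (divn^~ n) e; have := congr1 (modn^~ n) e.
rewrite /= !modnMDl !modn_small // !divnMDl // !divn_small // !addn0.
by move=> /val_inj -> /val_inj ->.
Qed.

Lemma pick_flat T n a (f : 'I_n -> 'I_n -> T) (x : T) k :
  (if [pick ij : 'I_n * 'I_n | (a + ij.1 * n + ij.2)%N == k] is Some ij
   then f ij.1 ij.2 else x) =
  (if [pick ij : 'I_n * 'I_n | (a + (ij.1 * n + ij.2))%N == k] is Some ij
   then f ij.1 ij.2 else x).
Proof. by congr (if _ is Some _ then _ else _); apply: eq_pick => ij; rewrite addnA. Qed.

Lemma pick_flat_in T n a (f : 'I_n -> 'I_n -> T) (x : T) (i j : 'I_n) :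
  (if [pick ij : 'I_n * 'I_n | (a + ij.1 * n + ij.2)%N == (a + (i * n + j))%N] is Some ij
   then f ij.1 ij.2 else x) = f i j.
Proof.
rewrite pick_flat; case: pickP => [[i' j'] /=|/(_ (i, j))]; last by rewrite eqxx.
by rewrite eqn_add2l flat_inj => /eqP [-> ->].
Qed.

Lemma pick_flat_out T n a (f : 'I_n -> 'I_n -> T) (x : T) k :
  ~~ (a <= k < a + n * n)%N ->
  (if [pick ij : 'I_n * 'I_n | (a + ij.1 * n + ij.2)%N == k] is Some ij
   then f ij.1 ij.2 else x) = x.
Proof.
move=> hk; rewrite pick_flat; case: pickP => [[i j] /= /eqP e|] //.
by have := flat_lt i j; lia.
Qed.

Lemma mm_input_memory n f g :
  regs (mm_input (matrix_of n f) (matrix_of n g)) =1 product_memory n f g (n * n) (n * n).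
Proof.
move=> k; rewrite /mm_input /product_memory /=; case: k => [|k] //=.
case: (ltnP k (n * n)) => kn.
  have [i [j ->]] := flat_split kn.
  by rewrite -add1n (pick_flat_in 1 (fun i j => matrix_of n f i j)) mxE.
rewrite (pick_flat_out (fun i j => matrix_of n f i j)); last by lia.
case: ifP => hk; last first.
  by rewrite (pick_flat_out (fun i j => matrix_of n g i j)) //; lia.
have [|i [j e]] := @flat_split n (k - n * n); first by lia.
rewrite e (_ : k.+1 = (1 + n * n) + (i * n + j))%N; last by lia.
by rewrite (pick_flat_in (1 + n * n) (fun i j => matrix_of n g i j)) mxE.
Qed.

Definition load_left := [:: Oadd 7 3 8; Oadd 7 7 1; Oload 5 2 8; Oqstore 7 5].
Definition load_right :=
  [:: Oadd 7 3 8; Oadd 7 7 1; Oadd 7 7 2; Oload 5 1 8; Oqstore 7 5].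
Definition read_back := [:: Oadd 7 3 8; Oadd 7 7 1; Oqload 5 7; Ostore 3 8 5].

Definition product_load : code :=
  cseq (fun=> compile ([:: Oconst 5 0; Oadd 4 11 5; Oconst 8 0] ++ q_write 0 0))
    (cseq (cfor 2 load_left) (cseq (fun=> compile [:: Oconst 8 0]) (cfor 2 load_right))).

Definition product_clear : code :=
  cseq (fun=> compile [:: Osub 9 4 11]) (cwhile 9 (fun=> compile [:: Oqclear; Osub 9 4 11])).

Definition product_code (Q : program) : code :=
  cseq product_load (cseq (simulate Q)
    (cseq (cseq (fun=> compile [:: Oconst 8 0]) (cfor 2 read_back)) product_clear)).

Section Product.
Variables (n B : nat).
Hypothesis n32 : (32 <= n)%N.

Lemma simulates_eq s0 s mq mq' : mq =1 mq' -> simulates n s0 s mq -> simulates n s0 s mq'.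
Proof.
by move=> e [h1 h2 h3 h4 h5]; split=> // k; rewrite -e; [apply: h1|apply: h2].
Qed.

Lemma constant_square x : constants n B x -> x 2%N = (n * n)%:R.
Proof. by case. Qed.

Lemma simulates_loop_register s0 s mq d y : (d == 8)%N || (d == 9)%N ->
  simulates n s0 s mq -> simulates n s0 (with_sc s (upd (sc s) d y)) mq.
Proof.
move=> hd; apply: simulates_sc; last by rewrite upd_other //; lia.
by apply: upd_high => //; lia.
Qed.

(** The input is written by logged stores too, one for n and one for each entry of the two factors;
    hence the log length 2n^2 + 1. *)
Lemma product_load_spec s : (2 * (n * n) + 1 <= B)%N -> qm s =1 (fun=> 0) -> lg s = [::] ->
  triple n B product_load (23 * (n * n) + 14) s (fun s' =>
    simulates n s s' (product_memory n (ar s 2%N) (ar s 1%N) (n * n) (n * n)) /\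
    size (lg s') = (2 * (n * n) + 1)%N).
Proof.
move=> BN q0 l0; apply: (triple_weaken (t := (8 + ((1 + ((n * n - 0) * 11 + 1)) +
    (1 + (1 + ((n * n - 0) * 12 + 1)))))%N) (Q := fun s' => simulates n s s'
    (product_memory n (ar s 2%N) (ar s 1%N) (n * n) (n * n)) /\
    size (lg s') = (2 * (n * n) + 1)%N)) => //; first by lia.
pose I1 i s' := simulates n s s' (product_memory n (ar s 2%N) (ar s 1%N) i 0) /\
    size (lg s') = i.+1.
pose I2 i s' := simulates n s s' (product_memory n (ar s 2%N) (ar s 1%N) (n * n) i) /\
    size (lg s') = (n * n + i.+1)%N.
apply: (triple_seq (Q := fun s' => sc s' 8 = 0%:R /\ I1 0%N s')).
  apply: triple_given_constants => cs; apply: triple_ops => //; apply: wp_cat.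
  have [c0 c1 c2 c3 [c11 _]] := cs.
  pose s1 := with_sc s (upd (upd (upd (sc s) 5 0) 4 (sc s 11 + 0)) 8 0).
  have sim1 : simulates n s s1 (fun=> 0).
    split=> //=; first by rewrite /upd /= l0 addn0 c11 addr0.
    by do !apply: upd_high.
  change (wp n B (q_write 0 0) (fun s' => sc s' 8 = 0 /\ I1 0%N s') s1).
  apply: wp_mono (wp_q_write n32 0 _ _ _ sim1) => //.
    move=> s' [h1 h2 h3]; rewrite h3 //; split=> //; split; last by rewrite h2 /= l0.
    apply: simulates_eq h1 => k; rewrite /s1 /product_memory /upd /= c0.
    by case: k => //= k; case: ifP => //; lia.
  by rewrite /= l0 /=; lia.
move=> s1 [s18 Is1].
apply: (triple_seq (Q := fun s' => sc s' 8 = (n * n)%:R /\ I1 (n * n)%N s')).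
  apply: (triple_for n32 (I := I1)) s18 Is1 => //; first exact: constant_square.
    move=> i s' d y hd [h1 h2]; split=> //; exact: simulates_loop_register.
  move=> i s' iN cs si [h1 h2]; have [_ c1 c2 c3 _] := cs; have [_ _ _ h4 _] := h1.
  exists i; split=> //; first by lia.
  apply: wp_mono (wp_q_store n32 (s0 := s) (k := i.+1)
    (mq := product_memory n (ar s 2%N) (ar s 1%N) i 0) 5 _ _ _ _) => //; last first.
  - by apply: simulates_sc h1 => //; do !apply: upd_high.
  - by rewrite /= h2; lia.
  - by rewrite /upd /= c1 c3 si -addrA natr1 -natrD addr_nat.
  move=> s2 [k1 k2 k3]; rewrite k3 //; split=> //; split; last by rewrite k2 /= h2.
  apply: simulates_eq k1 => k; rewrite /product_memory /upd /= h4 addn0 ltnS.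
  case: k => //= k; rewrite eqSS; case: (k =P i) => [->|ki]; first by rewrite leqnn.
  by rewrite (_ : (k < i)%N = (k <= i)%N) //; lia.
move=> s2 [s28 [h1 h2]]; apply: (triple_seq (Q := fun s' => sc s' 8 = 0%:R /\ I2 0%N s')).
  apply: triple_ops => //; split=> //; split; last by rewrite /= h2; lia.
  by apply: simulates_sc h1 => //; do !apply: upd_high.
move=> s3 [s38 Is3].
apply: triple_weaken (triple_for n32 (I := I2) _ _ _ _ _ _ _ s38 Is3) => //.
- by move=> s' [_ [k1 k2]]; split=> //; rewrite k2; lia.
- exact: constant_square.
- by move=> i s' d y hd [k1 k2]; split=> //; apply: simulates_loop_register.
move=> i s' iN cs si [{}h1 {}h2]; have [_ c1 c2 c3 _] := cs; have [_ _ _ h4 _] := h1.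
exists i; split=> //; first by have := large_square n32; lia.
apply: wp_mono (wp_q_store n32 (s0 := s) (k := (n * n + i).+1)
  (mq := product_memory n (ar s 2%N) (ar s 1%N) (n * n) i) 5 _ _ _ _) => //; last first.
- by apply: simulates_sc h1 => //; do !apply: upd_high.
- by rewrite /= h2; lia.
- rewrite -[RHS]addr_nat /upd /= c1 c2 c3 si; congr addr.
  by rewrite -addn1 !natrD; ring.
move=> s4 [k1 k2 k3]; rewrite k3 //; split=> //; split; last by rewrite k2 /= h2; lia.
apply: simulates_eq k1 => k; rewrite /product_memory /upd /= h4.
case: k => //= k; rewrite eqSS; case: (k =P _) => [->|ki].
  by rewrite ltnNge leq_addr /= ltn_add2l ltnS leqnn addKn.
by rewrite (_ : (n * n <= k < n * n + i.+1)%N = (n * n <= k < n * n + i)%N) //; lia.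
Qed.

Lemma read_back_spec s mq : simulates n s s mq ->
  triple n B (cseq (fun=> compile [:: Oconst 8 0]) (cfor 2 read_back))
    (1 + (1 + ((n * n - 0) * 9 + 1))) s (fun s' => exists a,
      [/\ simulates n (with_ar s a) s' mq, lg s' = lg s,
          forall k, (k < n * n)%N -> a 3%N k = mq k.+1 &
          forall t k, t != 3%N -> a t k = ar s t k]).
Proof.
move=> sim.
pose I i s' := exists a, [/\ simulates n (with_ar s a) s' mq, lg s' = lg s,
  forall k, (k < i)%N -> a 3%N k = mq k.+1 & forall t k, t != 3%N -> a t k = ar s t k].
apply: (triple_seq (Q := fun s' => sc s' 8 = 0%:R /\ I 0%N s')).
  apply: triple_ops => //; split=> //; exists (ar s); split=> //.
  by apply: (simulates_sc (s0 := with_ar s (ar s))) => //; do !apply: upd_high.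
move=> s1 [s18 Is1].
apply: triple_weaken (triple_for n32 (I := I) _ _ _ _ _ _ _ s18 Is1) => //.
- by move=> s' [].
- exact: constant_square.
- move=> i s' d y hd [a [h1 h2 h3 h4]]; exists a; split=> //.
  exact: simulates_loop_register.
move=> i s' iN cs si [a [h1 h2 h3 h4]]; have [_ c1 c2 c3 _] := cs.
have [g1 g2 g3 g4 g5] := h1.
exists i.+1; split; first by rewrite /upd /= c1 c3 si -addrA natr1 -natrD addr_nat.
exists i; split=> //; first by lia.
split=> //; exists (upda a 3 i (mq i.+1)); split=> //.
- split=> //=; first by rewrite /upd /= g1 g4.
  by do !apply: upd_high.
- move=> k; rewrite ltnS leq_eqVlt /upda /=; case: eqP => [->|_] //=.
  exact: h3.
- by move=> t k t3; rewrite /upda (negbTE t3) h4.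
Qed.

(** The invariant is that the remaining log still contains the support of the simulated memory; an
    empty log then forces that memory to be zero. A cell logged several times is simply zeroed
    several times. *)
Lemma product_clear_spec s mq l : simulates n s s mq -> (size (lg s) <= l)%N ->
  triple n B product_clear (7 * l + 2) s (fun s' => [/\ qm s' =1 fun=> 0, lg s' = [::],
    ar s' = ar s & forall r, (12 <= r)%N -> sc s' r = sc s r]).
Proof.
move=> [h1 h2 h3 _ _] sl.
pose I j s' := [/\ simulates n s s' (qm s'), size (lg s') = j & sc s' 9 = j%:R].
apply: (triple_weaken (t := (1 + (size (lg s) * (5 + 2) + 1))%N)
  (Q := I 0%N)); first by lia.
  move=> s' [[_ k2 _ k4 k5] /size0nil k6 _]; split=> // k.
  by apply/eqP; apply: contraT => /k2; rewrite k6.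
apply: (triple_seq (Q := I (size (lg s)))).
  apply: triple_given_constants => cs; have [_ _ _ _ [c11 _]] := cs.
  apply: triple_ops => //=; split=> //=; last first.
    by rewrite upd_same h3 c11 natrD addrAC subrr add0r.
  split=> //=; first by move=> k; rewrite h1; apply: h2.
  by do !apply: upd_high.
move=> s1 Is1; apply: (triple_while n32 (I := I) _ _ _ Is1) => //.
  by move=> j s' [_ _ ->]; rewrite pnatr_eq0.
move=> j s' [[k1 k2 k3 k4 k5] k6 k7].
apply: triple_given_constants => cs; have [_ _ _ _ [c11 _]] := cs.
apply: triple_ops => //.
case/lastP E: (lg s') k2 k3 k6 => [|l' k] // k2 k3; rewrite size_rcons => -[k6].
exists l', k; rewrite E; split=> // q; split=> //=.
- split=> //=.
  + move=> i; rewrite /upd; case: (i =P k) => [_|ik]; first by rewrite eqxx.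
    by move=> /k2; rewrite mem_rcons inE => /predU1P [].
  + by do !apply: upd_high.
- by rewrite /upd /= c11 k6 natrD addrAC subrr add0r.
Qed.

Lemma simulates_self s0 s mq : simulates n s0 s mq -> simulates n s s mq.
Proof. by case. Qed.

(** The condition between two products; register 4 is not mentioned because [product_load] resets
    it. *)
Definition idle s := qm s =1 (fun=> 0) /\ lg s = [::].

Lemma product_spec Q s T (A C : 'M[rat]_n) : idle s ->
  matrix_of n (ar s 2) = A -> matrix_of n (ar s 1) = C ->
  (2 * (n * n) + 1 + T <= B)%N ->
  halted Q (run Q T (mm_input A C)) ->
  (forall i j : 'I_n, regs (run Q T (mm_input A C)) (1 + i * n + j)%N = (A *m C) i j) ->
  triple n B (product_code Q) (50 * (n * n + T)) s (fun s' => [/\ idle s',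
    matrix_of n (ar s' 3) = A *m C, forall t, t != 3%N -> ar s' t = ar s t &
    forall r, (12 <= r)%N -> sc s' r = sc s r]).
Proof.
move=> [q0 l0] eA eC BT; have n2 := large_square n32.
have -> : mm_input A C = State 0 (product_memory n (ar s 2%N) (ar s 1%N) (n * n) (n * n)).
  rewrite -eA -eC; rewrite -[LHS]/(State 0 (regs (mm_input _ _))); congr State.
  by apply/funext/mm_input_memory.
set st := State _ _ => hQ rQ.
apply: (triple_weaken (t := ((23 * (n * n) + 14) + ((15 * T + 1) +
  ((1 + (1 + ((n * n - 0) * 9 + 1))) + (7 * (2 * (n * n) + 1 + T) + 2))))%N)
  (Q := fun s' => [/\ idle s',
    matrix_of n (ar s' 3) = A *m C, forall t, t != 3%N -> ar s' t = ar s t &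
    forall r, (12 <= r)%N -> sc s' r = sc s r])) => //; first by lia.
apply: triple_seq; first by apply: product_load_spec => //; lia.
move=> s1 [sim1 sz1].
apply: (triple_seq (Q := fun s' => simulates n s s' (regs (run Q T st)) /\
    (size (lg s') <= 2 * (n * n) + 1 + T)%N)).
  apply: triple_weaken (triple_simulate n32 sim1 _ hQ) => //; last by lia.
  by move=> s' [h1 h2]; split=> //; lia.
move=> s2 [sim2 sz2].
apply: triple_seq; first exact: (read_back_spec (simulates_self sim2)).
move=> s3 [a [sim3 sz3 a3 a_other]].
have [_ _ _ ar2 sc2] := sim2; have [_ _ _ ar3 sc3] := sim3.
apply: triple_weaken (product_clear_spec (simulates_self sim3) _) => //; last by rewrite sz3.
move=> s4 [q4 l4 ar4 sc4]; split=> //.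
- apply/matrixP => i j; rewrite mxE ar4 ar3 /= a3 ?flat_lt // -rQ.
  by congr regs; lia.
- by move=> t t3; rewrite ar4 ar3 /=; apply/funext => k; rewrite a_other // ar2.
- by move=> r r12; rewrite sc4 // sc3 // sc2.
Qed.

End Product.
(** * Shortest paths and betweenness centrality *)

Section Graph.
Variables (n : nat) (adj : rel 'I_n).
Hypothesis adj_conn : connected_graph adj.

Notation nwalks k s t := #|walks adj k s t|.
Notation d := (dist adj).
Notation lambda := (nb_sp adj).

Lemma card_tuple_cons k (Q : pred (k.+1.-tuple 'I_n)) :
  #|[set p | Q p]| = (\sum_u #|[set p : k.-tuple 'I_n | Q [tuple of u :: p]]|)%N.
Proof.
rewrite -sum1dep_card (partition_big (@thead _ _) xpredT) //=.
apply: eq_bigr => u _; rewrite -sum1dep_card.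
rewrite (reindex_onto (fun p : k.-tuple 'I_n => [tuple of u :: p]) (fun p => [tuple of behead p])) /=.
  apply: eq_bigl => p; rewrite theadE eqxx andbT.
  by rewrite [X in _ && X](_ : _ = true) ?andbT //; apply/eqP/val_inj.
by move=> p /andP [_ /eqP <-]; rewrite -tuple_eta.
Qed.

Lemma nwalks0 s t : nwalks 0 s t = (s == t).
Proof.
case: (s =P t) => [->|st]; last first.
  by apply: eq_card0 => p; rewrite inE (tuple0 p) /=; apply/eqP.
rewrite (eq_card (B := predT)) ?card_tuple ?expn0 // => p.
by rewrite inE (tuple0 p) /= eqxx.
Qed.

Lemma nwalksS k s t : nwalks k.+1 s t = (\sum_(u | adj s u) nwalks k u t)%N.
Proof.
rewrite card_tuple_cons [RHS]big_mkcond; apply: eq_bigr => u _ /=.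
case: ifP => su; last by apply: eq_card0 => p; rewrite !inE.
by apply: eq_card => p; rewrite !inE.
Qed.

(** A walk is cut at its vertex in position [i]; induction on [i] with the first-step recurrence
    replaces an explicit bijection of tuples. *)
Lemma nwalks_through i j s t v :
  #|[set p in walks adj (i + j) s t | nth s (s :: p) i == v]| = (nwalks i s v * nwalks j v t)%N.
Proof.
elim: i s => [|i IH] s.
  rewrite nwalks0 add0n /=; case: (s =P v) => [<-|sv]; rewrite ?mul1n ?mul0n.
    by apply: eq_card => p; rewrite !inE andbT.
  by apply: eq_card0 => p; rewrite !inE andbF.
rewrite nwalksS addSn.
rewrite (_ : [set p in _ | _] = [set p : (i + j).+1.-tuple 'I_n |
  (p \in walks adj (i + j).+1 s t) && (nth s (s :: p) i.+1 == v)]) //.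
rewrite card_tuple_cons big_distrl /= [RHS]big_mkcond; apply: eq_bigr => u _ /=.
case: ifP => su; last by apply: eq_card0 => p; rewrite !inE /= su.
rewrite -IH; apply: eq_card => p; rewrite !inE /= su /=; congr (_ && (_ == _)).
by apply: set_nth_default; rewrite /= size_tuple ltnS leq_addr.
Qed.

Lemma nwalks_add_gt0 i j s t v :
  (0 < nwalks i s v)%N -> (0 < nwalks j v t)%N -> (0 < nwalks (i + j) s t)%N.
Proof.
move=> h1 h2; apply: (@leq_trans (nwalks i s v * nwalks j v t)); first by rewrite muln_gt0 h1.
by rewrite -nwalks_through; apply/subset_leq_card/fintype.subsetP => p; rewrite inE => /andP [].
Qed.

Lemma ex_short_walk s t : exists2 k, (k < n)%N & (0 < nwalks k s t)%N.
Proof.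
have /connectP [p pp ->] := adj_conn s t.
case/shortenP: pp => p' pp' up _.
exists (size p'); last first.
  by rewrite card_gt0; apply/finset.set0Pn; exists (in_tuple p'); rewrite inE pp' /=.
by have := max_card (mem (s :: p')); rewrite card_ord (card_uniqP up).
Qed.

(** This excludes the default value n that [find] returns on failure, so [dist] is a true distance;
    it rests on the repetition-free path supplied by connectivity. *)
Lemma dist_lt s t : (d s t < n)%N.
Proof.
rewrite -[X in (_ < X)%N](size_iota 0) -has_find; apply/hasP.
by have [k kn wk] := ex_short_walk s t; exists k; rewrite ?mem_iota.
Qed.

Lemma nb_sp_gt0 s t : (0 < lambda s t)%N.
Proof.
have hh : has (fun k => 0 < nwalks k s t)%N (iota 0 n) by rewrite has_find size_iota dist_lt.
by have := nth_find 0%N hh; rewrite -/(dist adj s t) nth_iota ?dist_lt.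
Qed.

Lemma dist_le k s t : (0 < nwalks k s t)%N -> (d s t <= k)%N.
Proof.
move=> wk; rewrite leqNgt; apply/negP => kd.
have := @before_find _ 0%N (fun k => 0 < nwalks k s t)%N (iota 0 n) k kd.
by rewrite nth_iota ?add0n ?wk //; apply: ltn_trans (dist_lt s t).
Qed.

Lemma nwalks_dist k s t : (k <= d s t)%N -> nwalks k s t = if d s t == k then lambda s t else 0%N.
Proof.
case: eqP => [<-|dk kd] //; apply/eqP; rewrite -leqn0 leqNgt.
by apply/negP => /dist_le; lia.
Qed.

Lemma dist_triangle s v t : (d s t <= d s v + d v t)%N.
Proof. by apply/dist_le/(@nwalks_add_gt0 _ _ _ _ v); apply: nb_sp_gt0. Qed.

Lemma dist_refl s : d s s = 0%N.
Proof. by apply/eqP; rewrite -leqn0 dist_le // nwalks0 eqxx. Qed.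

Lemma dist_eq0 s t : (d s t == 0%N) = (s == t).
Proof.
apply/eqP/eqP => [h|->]; last exact: dist_refl.
by have := nb_sp_gt0 s t; rewrite /nb_sp h nwalks0; case: eqP.
Qed.

Lemma nb_sp_refl s : lambda s s = 1%N.
Proof. by rewrite /nb_sp dist_refl nwalks0 eqxx. Qed.

Lemma dist_adj u v : adj u v -> (d u v <= 1)%N.
Proof.
move=> uv; apply: dist_le; rewrite nwalksS (bigD1 v) //=.
by rewrite nwalks0 eqxx.
Qed.

(** If [v] occurs at position [i] of a shortest path, the two pieces have lengths at least d(s,v)
    and d(v,t), and the triangle inequality forces equality. Hence [v] can only occur at position
    d(s,v), where [nwalks_through] counts. *)
Lemma nb_sp_throughE s t v : nb_sp_through adj s t v =
  if (d s v + d v t == d s t)%N then (lambda s v * lambda v t)%N else 0%N.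
Proof.
have on_path (p : (d s t).-tuple 'I_n) i : p \in walks adj (d s t) s t -> (i <= d s t)%N ->
    nth s (s :: p) i = v -> [/\ d s v + d v t = d s t & i = d s v]%N.
  move=> pw ih iv.
  have : (0 < #|[set p in walks adj (i + (d s t - i)) s t | nth s (s :: p) i == v]|)%N.
    rewrite card_gt0; apply/finset.set0Pn; rewrite subnKC //.
    by exists p; rewrite inE pw iv eqxx.
  rewrite nwalks_through muln_gt0 => /andP [/dist_le h1 /dist_le h2].
  by have := dist_triangle s v t; lia.
have path_index (p : (d s t).-tuple 'I_n) : v \in s :: (p : seq 'I_n) ->
    (index v (s :: p) <= d s t)%N by rewrite -index_mem /= size_tuple.
rewrite /nb_sp_through; case: eqP => [e|ne].
  rewrite /nb_sp -nwalks_through e; apply: eq_card => p; rewrite !inE -in_cons.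
  apply: andb_id2l => pw; apply/idP/eqP => [vp|<-]; last first.
    by rewrite mem_nth //= size_tuple; lia.
  have [|||_ <-] := on_path p (index v (s :: p)); rewrite ?inE ?nth_index //.
  exact: path_index.
apply: eq_card0 => p; rewrite !inE -in_cons; apply/negbTE/negP => /andP [pw vp].
have [|||//] := on_path p (index v (s :: p)); rewrite ?inE ?nth_index //.
exact: path_index.
Qed.

Definition adjacency_matrix : 'M[rat]_n := \matrix_(i, j) (adj i j)%:R.

Fixpoint walk_matrix (k : nat) : 'M[rat]_n :=
  if k is k'.+1 then walk_matrix k' *m adjacency_matrix else 1%:M.

(** The program multiplies by the adjacency matrix on the right, while [nwalksS] removes the first
    step of a walk; this reconciles the two. *)
Lemma walk_matrixS k : walk_matrix k.+1 = adjacency_matrix *m walk_matrix k.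
Proof.
elim: k => [|k IH]; first by rewrite /= mul1mx mulmx1.
by rewrite /= -[in LHS]/(walk_matrix k.+1) IH -mulmxA.
Qed.

Lemma walk_matrixE k s t : walk_matrix k s t = (nwalks k s t)%:R.
Proof.
elim: k s => [|k IH] s; first by rewrite nwalks0 /= mxE.
rewrite walk_matrixS nwalksS !mxE natr_sum [RHS]big_mkcond; apply: eq_bigr => u _.
by rewrite mxE IH; case: ifP => _; rewrite ?mul1r ?mul0r.
Qed.

Lemma nb_sp_step w t : w != t ->
  lambda w t = (\sum_(u | adj w u && ((d u t).+1 == d w t)) lambda u t)%N.
Proof.
move=> wt; have : d w t != 0%N by rewrite dist_eq0.
case e: (d w t) => [|k] // _.
rewrite /nb_sp e nwalksS big_mkcondr; apply: eq_bigr => u wu.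
rewrite eqSS nwalks_dist //.
by have := dist_triangle w u t; have := dist_adj wu; lia.
Qed.

(** Brandes' dependency of [s] on [w] divided by lambda_sw, with endpoints included; this is
    Y_sw. *)
Definition dependency (s w : 'I_n) : rat :=
  \sum_(t | (d s w + d w t)%N == d s t) (lambda w t)%:R / (lambda s t)%:R.

(** The term t = w gives 1 / lambda_sw. For the others lambda_wt is split by the first step u, and
    the sums over t and u are exchanged. The triangle inequality shows that a u contributes only
    when it is one level farther from [s], and that its t are then exactly those summed in Y_su. *)
Lemma dependency_step s w : dependency s w = (lambda s w)%:R^-1 +
  \sum_(u | adj w u && (d s u == (d s w).+1)) dependency s u.
Proof.
rewrite /dependency (bigD1 w) /=; last by rewrite dist_refl addn0.
rewrite nb_sp_refl mul1r; congr (_ + _).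
rewrite (eq_bigr (fun t => \sum_(u | adj w u && ((d u t).+1 == d w t))
  (lambda u t)%:R / (lambda s t)%:R)); last first.
  by move=> t /andP [_ tw]; rewrite (nb_sp_step (w := w)) 1?eq_sym // natr_sum mulr_suml.
rewrite (exchange_big_dep (fun u => adj w u)) /=; last by move=> t u _ /andP [].
rewrite [RHS]big_mkcondr /=; apply: eq_bigr => u wu.
rewrite wu /=; case: eqP => [su|su].
  apply: eq_bigl => t.
  have h1 := dist_triangle s w t; have h2 := dist_triangle s u t.
  have h3 := dist_triangle w u t; have h4 := dist_adj wu.
  have h5 : t = w -> d w t = 0%N by move=> ->; apply: dist_refl.
  case: (t =P w) => [/h5 h|_]; first by lia.
  by lia.
apply: big1 => t /andP [/andP [/eqP h _] /eqP h'].
have h1 := dist_triangle s w u; have h2 := dist_triangle s u t.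
by have h4 := dist_adj wu; lia.
Qed.

(** The full double sum includes the pairs with s = v or t = v, which [BC] omits. Each of the n - 1
    rows s <> v has the extra term delta_sv(v) = 1, and the row s = v sums to n: in total 2n - 1. *)
Lemma BC_dependency v :
  BC adj v = \sum_s (lambda s v)%:R * dependency s v - (2 * n)%:R + 1.
Proof.
have pos s t : (lambda s t)%:R != 0 :> rat by rewrite pnatr_eq0 -lt0n nb_sp_gt0.
have deltaE s t : delta adj s t v =
    if (d s v + d v t == d s t)%N then (lambda s v)%:R * ((lambda v t)%:R / (lambda s t)%:R)
    else 0.
  by rewrite /delta nb_sp_throughE; case: ifP => _; rewrite ?mul0r // natrM mulrA.
have row s : \sum_(t | t != v) delta adj s t v = (lambda s v)%:R * dependency s v - 1.
  have : \sum_t delta adj s t v = (lambda s v)%:R * dependency s v.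
    rewrite /dependency mulr_sumr [RHS]big_mkcond; apply: eq_bigr => t _; exact: deltaE.
  rewrite (bigD1 v) //= deltaE dist_refl addn0 eqxx nb_sp_refl mul1r divff // => <-.
  by rewrite addrAC subrr add0r.
rewrite /BC (eq_bigr _ (fun s _ => row s)) big_split /= sumr_const cardC1 card_ord.
rewrite [X in _ = X - _ + _](bigD1 v) //=.
have -> : (lambda v v)%:R * dependency v v = n%:R.
  rewrite nb_sp_refl mul1r /dependency (eq_bigl xpredT); last first.
    by move=> t; rewrite dist_refl add0n eqxx.
  rewrite (eq_bigr (fun=> 1)); last by move=> t _; rewrite divff.
  by rewrite sumr_const card_ord.
have n0 : (0 < n)%N by apply: leq_trans (ltn_ord v).
have e : n%:R = n.-1%:R + 1 :> rat by rewrite natr1 prednK.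
by rewrite natrM e -[(- 1) *+ _]mulr_natl; ring.
Qed.

Lemma dist_le_diam s t : (d s t <= diam adj)%N.
Proof.
apply: leq_trans (leq_bigmax (F := fun s => \max_t dist adj s t) s).
exact: (leq_bigmax (F := dist adj s) t).
Qed.

Lemma diam_attained k : (forall s t, (d s t <= k)%N) -> (diam adj <= k)%N.
Proof. by move=> h; apply/bigmax_leqP => s _; apply/bigmax_leqP => t _. Qed.

Lemma diam_gt0 : (1 < n)%N -> (0 < diam adj)%N.
Proof.
move=> n1; have := dist_le_diam (Ordinal (ltnW n1)) (Ordinal n1).
by apply: leq_trans; rewrite lt0n dist_eq0.
Qed.

End Graph.
(** * The algorithm *)

Section Loops.
Variables (n B : nat).
Hypothesis n32 : (32 <= n)%N.

(** For loops whose iteration [i] changes only the cells of index [i], which are still original when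
    it starts. [new] gives the final contents and [G] follows the scalar accumulators. *)
Lemma triple_pointwise r body s E i0 (new : nat -> nat -> rat) (G : nat -> (nat -> rat) -> Prop) :
  readable r -> r != 8%N -> well_formed body -> (i0 <= E)%N ->
  (forall x, constants n B x -> x r = E%:R) ->
  (forall i x d y, (d == 8)%N || (d == 9)%N -> G i x -> G i (upd x d y)) ->
  (forall i s', (i0 <= i < E)%N -> constants n B (sc s') -> sc s' 8 = i%:R ->
     (forall t, ar s' t i = ar s t i) -> G i (sc s') ->
     wp n B body (fun s'' => [/\ sc s'' 8 = i%:R, qm s'' = qm s', lg s'' = lg s',
       forall t k, ar s'' t k = if k == i then new t k else ar s' t k & G i.+1 (sc s'')]) s') ->
  sc s 8 = i0%:R -> G i0 (sc s) ->
  triple n B (cfor r body) (1 + ((E - i0) * (size (compile body) + 4) + 1)) s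
    (fun s' => [/\ qm s' = qm s, lg s' = lg s,
      forall t k, ar s' t k = if (i0 <= k < E)%N then new t k else ar s t k & G E (sc s')]).
Proof.
move=> rr r8 wb iE rE stab hb s8 G0.
pose I i s' := (i0 <= i)%N /\ [/\ qm s' = qm s, lg s' = lg s,
  forall t k, ar s' t k = if (i0 <= k < i)%N then new t k else ar s t k & G i (sc s')].
have I0 : I i0 s.
  by split=> //; split=> // t k; rewrite ifN //; lia.
apply: triple_weaken (triple_for n32 (I := I) rr r8 wb iE rE _ _ s8 I0) => //.
- by move=> s' [_ [_ []]].
- by move=> i s' d y hd [h [h1 h2 h3 h4]]; split=> //; split=> //; apply: stab.
move=> i s' iE' cs si [h0 [h1 h2 h3 h4]].
apply: (wp_mono _ (hb i s' _ cs si _ h4)); last 2 first.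
- by rewrite h0.
- by move=> t; rewrite h3 ltnn andbF.
move=> s'' [k1 k2 k3 k4 k5]; split=> //; split; first by lia.
split; rewrite ?k2 ?k3 // => t k; rewrite k4; case: (k =P i) => [->|ki].
  by rewrite h0 ltnS leqnn.
by rewrite h3 (_ : (i0 <= k < i.+1)%N = (i0 <= k < i)%N) //; lia.
Qed.

End Loops.

Definition copy_body := [:: Oload 5 0 8; Ostore 1 8 5].
(* The scalars have overwritten the first row of the input; by symmetry it is restored from the
   first column, whose top entry (fresh memory, hence 0) is correct because there are no loops.
   Register 13 runs through the diagonal. *)
Definition seed_body := [:: Oload 5 1 12; Ostore 1 8 5; Ostore 3 13 1;
  Oadd 12 12 0; Oadd 13 13 0; Oadd 13 13 1].
(* Since x / 0 = 0, the quotient x / x is the indicator of x <> 0, which avoids branching. *)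
Definition record_body := [:: Oload 5 3 8; Ostore 2 8 5; Oload 6 5 8; Odiv 7 6 6;
  Osub 7 1 7; Omul 14 7 5; Oadd 6 6 14; Ostore 5 8 6; Odiv 14 14 14; Omul 14 14 16;
  Oload 15 4 8; Oadd 15 15 14; Ostore 4 8 15; Odiv 6 6 6; Omul 17 17 6].
Definition zero_body := [:: Oconst 5 0; Ostore 3 8 5].
(** Register 5 becomes the indicator that the distance equals the current level. The value found
    there goes both to the left factor of the next product and into the accumulated dependencies. *)
Definition level_body := [:: Oload 5 4 8; Osub 5 5 16; Odiv 5 5 5; Osub 5 1 5;
  Oload 6 5 8; Odiv 6 1 6; Oload 7 3 8; Oadd 6 6 7; Omul 6 6 5; Ostore 2 8 6;
  Oload 7 6 8; Oadd 7 7 6; Ostore 6 8 7].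
(** Prepares one last product: the all-ones matrix times the matrix of lambda_sv Y_sv has the column
    sums over s in each of its rows. *)
Definition weight_body := [:: Oload 5 5 8; Oload 6 6 8; Omul 5 5 6; Ostore 1 8 5; Ostore 2 8 1].
Definition correct_body := [:: Oload 5 3 8; Osub 5 5 12; Ostore 3 8 5].
Definition output_body := [:: Oload 5 3 8; Ostore 0 8 5].

(** Copying starts at cell n, because the scalars have damaged row 0. *)
Definition setup_code : code :=
  cseq (fun=> compile [:: Oconst 5 0; Oadd 8 0 5])
  (cseq (cfor 2 copy_body)
  (cseq (fun=> compile [:: Oconst 8 0; Oconst 12 0; Oconst 13 0; Oconst 16 0])
    (cfor 0 seed_body))).

(** Register 17 is the product of the indicators of recorded path counts, so register 18 is 1 as
    long as some pair has not been reached. The diameter is thus detected without being known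
    beforehand. *)
Definition record_code : code :=
  cseq (fun=> compile [:: Oconst 8 0; Oconst 17 1])
  (cseq (cfor 2 record_body) (fun=> compile [:: Osub 18 1 17])).

Definition count_code (Q : program) : code :=
  cseq record_code
    (cwhile 18 (cseq (product_code Q) (cseq (fun=> compile [:: Oadd 16 16 1]) record_code))).

Definition level_code : code :=
  cseq (fun=> compile [:: Oconst 8 0]) (cfor 2 level_body).

Definition dependency_code (Q : program) : code :=
  cseq (fun=> compile [:: Oconst 8 0])
  (cseq (cfor 2 zero_body)
  (cseq (fun=> compile [:: Oadd 18 16 1])
    (cwhile 18 (cseq level_code
      (cseq (product_code Q) (fun=> compile [:: Osub 16 16 1; Osub 18 18 1])))))).

Definition sum_code (Q : program) : code :=
  cseq (fun=> compile [:: Oconst 8 0])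
  (cseq (cfor 2 weight_body)
  (cseq (product_code Q)
  (cseq (fun=> compile [:: Oadd 12 0 0; Osub 12 12 1; Oconst 8 0])
  (cseq (cfor 0 correct_body)
  (cseq (fun=> compile [:: Oconst 8 31]) (cfor 0 output_body)))))).

Definition initial_arrays (n : nat) (adj : rel 'I_n) (t k : nat) : rat :=
  if (t == 0)%N then regs (graph_input adj) k.+1 else 0.

(** The k-th power is still in the product array and only distances below k are known. In
    [recorded], level k has been entered and the power moved to the left factor for the next
    product. *)
Definition ready (n : nat) (adj : rel 'I_n) (k : nat) (s : abstract) : Prop :=
  [/\ idle s, matrix_of n (ar s 1) = adjacency_matrix adj,
  matrix_of n (ar s 3) = walk_matrix adj k, sc s 16 = k%:R &
  [/\ forall i j : 'I_n, ar s 4 (i * n + j)%N =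
        if (dist adj i j < k)%N then (dist adj i j)%:R else 0,
      forall i j : 'I_n, ar s 5 (i * n + j)%N =
        if (dist adj i j < k)%N then (nb_sp adj i j)%:R else 0 &
      forall l, (l < n * n)%N -> ar s 6 l = 0]].

Definition recorded (n : nat) (adj : rel 'I_n) (k : nat) (s : abstract) : Prop :=
  [/\ idle s, matrix_of n (ar s 1) = adjacency_matrix adj,
  matrix_of n (ar s 2) = walk_matrix adj k, sc s 16 = k%:R &
  [/\ sc s 18 = (k < diam adj)%N%:R,
      forall i j : 'I_n, ar s 4 (i * n + j)%N =
        if (dist adj i j <= k)%N then (dist adj i j)%:R else 0,
      forall i j : 'I_n, ar s 5 (i * n + j)%N =
        if (dist adj i j <= k)%N then (nb_sp adj i j)%:R else 0 &
      forall l, (l < n * n)%N -> ar s 6 l = 0]].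

(** * Restoring the adjacency matrix and creating the identity *)

Section Setup.
Variables (n B : nat) (adj : rel 'I_n).
Hypothesis n32 : (32 <= n)%N.
Hypotheses (adj_irr : irreflexive adj) (adj_sym : symmetric adj).

Lemma constant_n x : constants n B x -> x 0%N = n%:R.
Proof. by case. Qed.

Lemma setup_spec s : ar s = initial_arrays adj -> idle s ->
  triple n B setup_code (50 * (n * n)) s (ready adj 0).
Proof.
move=> ars [q0 l0]; have n2 := large_square n32.
apply: (triple_weaken (t := (2 + ((1 + ((n * n - n) * (4 + 4) + 1)) +
  (4 + (1 + ((n - 0) * (9 + 4) + 1)))))%N) (Q := ready adj 0)) => //.
  by nia.
apply: (triple_seq (Q := fun s' => [/\ sc s' 8 = n%:R, qm s' = qm s, lg s' = lg s & ar s' = ar s])).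
  apply: triple_given_constants => cs; apply: triple_ops => //; split=> //.
  by rewrite /upd /= addr0 (constant_n cs).
move=> s1 [s18 q1 l1 a1].
pose new t k : rat := if t == 1%N then initial_arrays adj 0 k else ar s1 t k.
apply: triple_seq.
  apply: (triple_pointwise n32 (new := new) (G := fun _ _ => True)) s18 I => //.
  - by nia.
  - exact: constant_square.
  move=> i s' /andP [ni iN] cs si si' _; exists i; split=> //; first by lia.
  exists i; split=> //; first by lia.
  split=> //= t k; rewrite /upda /new; case: (k =P i) => [->|_]; last by rewrite andbF.
  by rewrite andbT; case: eqP => [_|_] //; rewrite /upd /= si' a1 ars.
move=> s2 [q2 l2 a2 _].
pose seeded i s' := [/\ [/\ qm s' = qm s, lg s' = lg s, sc s' 12 = (i * n)%:R,
  sc s' 13 = (i * n.+1)%:R & sc s' 16 = 0], forall k, (k < n * n)%N ->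
    ar s' 1 k = (if (k < i)%N then ar s2 1%N (k * n)%N else ar s2 1%N k),
  forall k, (k < n * n)%N -> ar s' 3 k = ((n.+1 %| k) && (k < i * n.+1))%N%:R &
  forall t k, t != 1%N -> t != 3%N -> ar s' t k = ar s2 t k].
apply: (triple_seq (Q := fun s' => sc s' 8 = 0%:R /\ seeded 0%N s')).
  apply: triple_ops => //; split=> //; split; first by split=> //=; congruence.
  - by move=> k kn; rewrite ltn0.
  - by move=> k kn; rewrite mul0n andbF a2 /new /= if_same a1 ars.
  - by [].
move=> s3 [s38 Is3].
apply: triple_weaken (triple_for n32 (I := seeded) _ _ _ _ _ _ _ s38 Is3) => //; last 3 first.
- exact: constant_n.
- move=> i s' e y he [[h1 h2 h3 h4 h5] h6 h7 h8]; split=> //; split=> //=; rewrite upd_other //.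
  + by case/orP: he => /eqP ->.
  + by case/orP: he => /eqP ->.
  + by case/orP: he => /eqP ->.
- move=> i s' iN cs si [[h1 h2 h3 h4 h5] h6 h7 h8].
  have in2 : (i * n < n * n)%N by rewrite ltn_mul2r; lia.
  exists (i * n)%N; split=> //; first by lia.
  exists i; split=> //; [by nia|by lia|].
  exists (i * n.+1)%N; split=> //; [by nia|by lia|].
  have [c0 c1 _ _ _] := cs.
  split=> //; split.
  + split=> //=; first by rewrite /upd /= h3 c0 -natrD; congr _%:R; lia.
      by rewrite /upd /= h4 c0 c1 -natrD natr1; congr _%:R; lia.
  + move=> k kn; rewrite /= /upda /= /upd /= ltnS; case: (k =P i) => [->|ki].
      by rewrite leqnn h6 // ltnNge leq_pmulr //; lia.
    by rewrite h6 // (_ : (k <= i)%N = (k < i)%N) //; lia.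
  + move=> k kn; rewrite /= /upda /= /upd /=; case: (k =P (i * n.+1)%N) => [->|ki].
      by rewrite dvdn_mull // c1 ltn_mul2r ltnS leqnn.
    rewrite h7 //; congr (nat_of_bool _)%:R; apply: andb_id2l => /dvdnP [q eq].
    by move: ki; rewrite eq !ltn_mul2r /= ltnS => ki; case: (ltngtP q i) => // qi; rewrite qi in ki.
  + by move=> t k t1 t3; rewrite /= /upda (negbTE t1) (negbTE t3) /= h8.
move=> s4 [_ [[h1 h2 _ _ h5] h6 h7 h8]]; split=> //; first by rewrite /idle h1 h2.
- apply/matrixP => i j; rewrite !mxE h6 ?flat_lt //.
  have input (u v : 'I_n) : initial_arrays adj 0 (u * n + v) = (adj u v)%:R.
    by rewrite /initial_arrays /graph_input /= -add1n (pick_flat_in 1 (fun i j => (adj i j)%:R)).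
  case: (posnP i) => [i0|i0].
    rewrite i0 mul0n add0n ltn_ord a2 /new /=.
    case: (posnP j) => [j0|j0].
      have -> : j = i by apply: val_inj; rewrite /= j0 i0.
      by rewrite adj_irr i0 mul0n ifN ?a1 ?ars //; lia.
    rewrite ifT; last by have := ltn_ord j; nia.
    by rewrite adj_sym -input i0 addn0.
  have ni : (n <= i * n + j)%N by nia.
  by rewrite ifN -?leqNgt // a2 ni flat_lt /new /= input.
- apply/matrixP => i j; rewrite !mxE h7 ?flat_lt //; congr (nat_of_bool _)%:R.
  have := ltn_ord i; have := ltn_ord j => jn im.
  rewrite (_ : (_ < _)%N = true) ?andbT; last by nia.
  (* A multiple q(n + 1) = qn + q with q < n is the flat index of the diagonal entry (q, q). *)
  apply/dvdnP/eqP => [[q e]|->]; last by exists j; rewrite mulnS addnC.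
  have qn : (q < n)%N by nia.
  have := flat_inj i j (Ordinal qn) (Ordinal qn); rewrite /= e mulnS addnC eqxx.
  by move/esym/eqP => [-> ->].
- split=> [i j|i j|k kn]; rewrite h8 // a2 /new /= if_same a1 ars //.
Qed.

End Setup.

Definition scalar_value (o : op) (s : abstract) : option (nat * rat) :=
  match o with
  | Oconst d q => Some (d, q)
  | Oadd d a b => Some (d, sc s a + sc s b)
  | Osub d a b => Some (d, sc s a - sc s b)
  | Omul d a b => Some (d, sc s a * sc s b)
  | Odiv d a b => Some (d, sc s a / sc s b)
  | _ => None
  end.

(* Naming the computed value keeps the symbolic states linear in the length of the code. *)
Lemma wp_scalar n B o os Q s :
  (if scalar_value o s is Some (d, w) then
     forall v, v = w -> wp n B os Q (with_sc s (upd (sc s) d v)) else False) ->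
  wp n B (o :: os) Q s.
Proof. by case: o => //= [d q|d a b|d a b|d a b|d a b]; apply. Qed.

Lemma wp_load n B d t i os Q k s :
  sc s i = k%:R -> (k < n * n)%N -> (32 <= t * (n * n) + 1 + k)%N ->
  (forall v, v = ar s t k -> wp n B os Q (with_sc s (upd (sc s) d v))) ->
  wp n B (Oload d t i :: os) Q s.
Proof. by move=> si kn h32 h; exists k; split=> //; apply: h. Qed.

Lemma wp_store n B t i a os Q k s :
  sc s i = k%:R -> (k < n * n)%N -> (32 <= t * (n * n) + 1 + k)%N ->
  wp n B os Q (with_ar s (upda (ar s) t k (sc s a))) ->
  wp n B (Ostore t i a :: os) Q s.
Proof. by move=> si kn h32 h; exists k. Qed.

Lemma wp_nil n B (Q : abstract -> Prop) s : Q s -> wp n B [::] Q s.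
Proof. by []. Qed.

Arguments upd m d q i /.
Arguments upda a t k q t' k' /.
Arguments with_sc s x /.
Arguments with_ar s x /.
Arguments wp : simpl never.

Ltac wp_run k := repeat first
  [ apply: wp_scalar; let e := fresh "e" in move=> /= ? e
  | apply: (wp_load (k := k)); [by []|by []|by lia|let e := fresh "e" in move=> /= ? e]
  | apply: (wp_store (k := k)); [by []|by []|by lia|rewrite /=] ];
  apply: wp_nil; rewrite /=.

(** * Counting shortest paths, accumulating dependencies, summing up *)

Section Phases.
Variables (n B TB : nat) (adj : rel 'I_n) (Q : program).
Hypothesis n32 : (32 <= n)%N.
Hypothesis adj_sym : symmetric adj.
Hypothesis adj_conn : connected_graph adj.
Hypothesis BT : (2 * (n * n) + 1 + TB <= B)%N.
Hypothesis Q_correct : forall A C : 'M[rat]_n, exists T, [/\ (T <= TB)%N,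
  halted Q (run Q T (mm_input A C)) &
  forall i j : 'I_n, regs (run Q T (mm_input A C)) (1 + i * n + j)%N = (A *m C) i j].

Notation d := (dist adj).
Notation lambda := (nb_sp adj).
Notation E := (n * n + TB)%N.

Lemma triple_product s : idle s ->
  triple n B (product_code Q) (50 * E) s (fun s' => [/\ idle s',
    matrix_of n (ar s' 3) = matrix_of n (ar s 2) *m matrix_of n (ar s 1),
    forall t, t != 3%N -> ar s' t = ar s t &
    forall r, (12 <= r)%N -> sc s' r = sc s r]).
Proof.
move=> ids; have [T [TT hQ rQ]] := Q_correct (matrix_of n (ar s 2)) (matrix_of n (ar s 1)).
apply: triple_weaken (product_spec n32 (T := T) ids erefl erefl _ hQ rQ) => //; lia.
Qed.

Lemma iotaS_all (p : pred nat) i : all p (iota 0 i.+1) = all p (iota 0 i) && p i.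
Proof. by rewrite -addn1 iotaD all_cat /= andbT. Qed.

Lemma all_dist_le k : (diam adj <= k)%N = [forall i, forall j, (d i j <= k)%N].
Proof.
apply/idP/forallP => [h i|h].
  by apply/forallP => j; apply: leq_trans h; apply: dist_le_diam.
by apply: diam_attained => i j; have /forallP := h i.
Qed.

(** The factor [1 - l / l] is 1 exactly where no count is recorded yet, so only the first nonzero
    walk count is kept, together with its level. *)
Definition record_new (s : abstract) (t i : nat) : rat :=
  let z := ar s 3%N i in let l := ar s 5%N i in
  if t == 2%N then z else if t == 5%N then l + (1 - l / l) * z else
  if t == 4%N then ar s 4%N i + ((1 - l / l) * z) / ((1 - l / l) * z) * sc s 16%N
  else ar s t i.

Lemma record_body_spec s i : (i < n * n)%N -> constants n B (sc s) -> sc s 8 = i%:R ->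
  wp n B record_body (fun s' => [/\ sc s' 8 = i%:R, qm s' = qm s, lg s' = lg s,
    forall t k, ar s' t k = if k == i then record_new s t i else ar s t k &
    sc s' 16 = sc s 16 /\ let l := record_new s 5 i in sc s' 17 = sc s 17 * (l / l)]) s.
Proof.
move=> iN cs si; have n2 := large_square n32; have [_ c1 _ _ _] := cs.
wp_run i; subst; rewrite c1; split=> // t k; rewrite /record_new.
case: (k =P i) => [->|_]; last by rewrite !andbF.
by rewrite !andbT; case: t => [|[|[|[|[|[|t]]]]]].
Qed.

Lemma record_spec k s : ready adj k s -> triple n B record_code (50 * E) s (recorded adj k).
Proof.
move=> [ids eA eW sk [eD eL e6]]; have n2 := large_square n32.
apply: (triple_weaken (t := (2 + ((1 + ((n * n - 0) * (21 + 4) + 1)) + 1))%N)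
  (Q := recorded adj k)) => //; first by lia.
pose new := record_new s.
pose G i x : Prop := x 16%N = sc s 16 /\
  x 17%N = (all (fun j => new 5%N j != 0) (iota 0 i))%:R :> rat.
apply: (triple_seq (Q := fun s' => [/\ sc s' 8 = 0%:R, idle s', ar s' = ar s & G 0%N (sc s')])).
  exact: triple_ops.
move=> s1 [s18 id1 a1 G1].
apply: triple_seq.
  apply: (triple_pointwise n32 (new := new) (G := G)) s18 G1 => //.
  - exact: constant_square.
  - by move=> i x e y /orP [] /eqP -> [h1 h2].
  move=> i s' /= iN cs si si' [g1 g2].
  have e t : record_new s' t i = new t i by rewrite /new /record_new !si' a1 g1.
  apply: wp_mono (record_body_spec iN cs si) => s'' [h1 h2 h3 h4 [h5 h6]].
  split=> //; first by move=> t j; rewrite h4; case: (j =P i) => [->|_]; rewrite ?e.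
  split; first by rewrite h5.
  rewrite h6 e g2 iotaS_all andbC; case: (_ =P 0) => [->|/eqP l0].
    by rewrite mul0r mulr0.
  by rewrite divff // mulr1.
move=> s2 [q2 l2 a2 [g1 g2]].
apply: triple_given_constants => cs; have [_ c1 _ _ _] := cs.
have e2 i : (i < n * n)%N -> ar s2 2 i = ar s 3 i by move=> iN; rewrite a2 iN.
have old (t i : nat) : t != 2%N -> t != 4%N -> t != 5%N -> ar s2 t i = ar s t i.
  by move=> t2 t4 t5; rewrite a2 a1 /new /record_new (negbTE t2) (negbTE t4) (negbTE t5) if_same.
have lambda_neq0 i j : (lambda i j)%:R != 0 :> rat.
  by rewrite pnatr_eq0 -lt0n nb_sp_gt0.
have walks (i j : 'I_n) : ar s 3 (i * n + j)%N = #|walks adj k i j|%:R.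
  by rewrite -walk_matrixE -eW mxE.
(* Below distance k the flag blocks the update, beyond it there are no walks of length k, and at
   distance k the walk count is lambda. *)
have e5 (i j : 'I_n) : new 5%N (i * n + j)%N = if (d i j <= k)%N then (lambda i j)%:R else 0.
  rewrite /new /record_new /= eL walks; case: (ltngtP (d i j) k) => [h|h|h] /=.
  - by rewrite (divff (lambda_neq0 i j)) subrr mul0r addr0.
  - by rewrite nwalks_dist ?(ltnW h) // gtn_eqF // mulr0 addr0.
  - by rewrite mul0r subr0 mul1r add0r nwalks_dist -?h // eqxx.
have e4 (i j : 'I_n) : new 4%N (i * n + j)%N = if (d i j <= k)%N then (d i j)%:R else 0.
  rewrite /new /record_new /= eL eD walks sk; case: (ltngtP (d i j) k) => [h|h|h] /=.
  - by rewrite (divff (lambda_neq0 i j)) subrr !mul0r addr0.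
  - by rewrite nwalks_dist ?(ltnW h) // gtn_eqF // !mulr0 !mul0r addr0.
  - by rewrite mul0r subr0 mul1r add0r nwalks_dist -?h // eqxx divff // mul1r.
apply: triple_ops => //; apply: wp_scalar => _ ->; split=> //=.
- by rewrite /idle q2 l2.
- by rewrite -eA; apply/matrixP => i j; rewrite !mxE old.
- by rewrite -eW; apply/matrixP => i j; rewrite !mxE e2 ?flat_lt.
- by rewrite g1.
split.
(* All counts are nonzero exactly when every distance is at most k. *)
- rewrite c1 g2; have -> : all (fun j => new 5%N j != 0) (iota 0 (n * n)) = (diam adj <= k)%N.
    rewrite all_dist_le; apply/allP/forallP => [h i|h l].
      apply/forallP => j; have := h (i * n + j)%N.
      by rewrite mem_iota flat_lt e5 => /(_ isT); case: ifP => // _; rewrite eqxx.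
    rewrite mem_iota => /flat_split [i [j ->]]; have /forallP/(_ j) dk := h i.
    by rewrite e5 dk.
  by case: leqP; rewrite ?subrr ?subr0.
- by move=> i j; rewrite a2 flat_lt e4.
- by move=> i j; rewrite a2 flat_lt e5.
- by move=> l lN; rewrite old ?e6.
Qed.

Lemma count_spec s : ready adj 0 s ->
  triple n B (count_code Q) (150 * E * (diam adj).+1) s (recorded adj (diam adj)).
Proof.
move=> rs; have n2 := large_square n32.
pose I j s' := (j <= diam adj)%N /\ recorded adj (diam adj - j) s'.
apply: (triple_weaken (t := (50 * E + (diam adj * ((50 * E + (1 + 50 * E)) + 2) + 1))%N)
  (Q := I 0%N)).
- have : (32 <= E)%N by lia.
  move: E (diam adj) => e D e32.
  have h : (3 * D <= e * D)%N by rewrite leq_mul2r; lia.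
  by nia.
- by move=> s' [_]; rewrite subn0.
apply: triple_seq; first exact: record_spec rs.
move=> s1 rs1; apply: (triple_while n32 (I := I)) => //; last by split; rewrite ?subnn.
  move=> j s' [jD [_ _ _ _ [-> _ _ _]]]; rewrite pnatr_eq0.
  by case: j jD => [|j] jD; [rewrite subn0 ltnn|rewrite (_ : (_ < _)%N)] => //; lia.
move=> j s' [jD [ids eA eW sk [_ eD eL e6]]].
have e : (diam adj - j = (diam adj - j.+1).+1)%N by lia.
apply: triple_seq; first exact: triple_product.
move=> s2 [id2 e3 old sc2].
apply: (triple_seq (Q := ready adj (diam adj - j))); last first.
  by move=> s3 /record_spec h; apply: triple_weaken h => // s4; split=> //; lia.
apply: triple_given_constants => cs; have [_ c1 _ _ _] := cs.
apply: triple_ops => //; apply: wp_scalar => _ ->; split=> //=.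
- by rewrite old.
- by rewrite e3 eW eA e.
- by rewrite sc2 // sk c1 e natr1.
- split=> [i l|i l|l lN]; rewrite old ?e6 // ?eD ?eL e ltnS //.
Qed.

Definition level_value (s : abstract) (i : nat) : rat :=
  let x := ar s 4%N i - sc s 16%N in ((ar s 5%N i)^-1 + ar s 3%N i) * (1 - x / x).

Lemma level_body_spec s i : (i < n * n)%N -> constants n B (sc s) -> sc s 8 = i%:R ->
  wp n B level_body (fun s' => [/\ sc s' 8 = i%:R, qm s' = qm s, lg s' = lg s,
    forall t k, ar s' t k = if k == i then
      if t == 2%N then level_value s i else
      if t == 6%N then level_value s i + ar s 6 i else ar s t i else ar s t k &
    sc s' 16 = sc s 16 /\ sc s' 18 = sc s 18]) s.
Proof.
move=> iN cs si; have n2 := large_square n32; have [_ c1 _ _ _] := cs.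
wp_run i; subst; rewrite c1; split=> // t k; rewrite /level_value div1r.
case: (k =P i) => [->|_]; last by rewrite !andbF.
by rewrite !andbT; case: t => [|[|[|[|[|[|[|t]]]]]]] //=; rewrite addrC.
Qed.

(** Levels j and above are finished, and array 3 already holds the neighbour sums needed at level j
    - 1. Register 16 is that level as a rational, so it ends at -1 when j = 0. *)
Definition levelled (j : nat) (s : abstract) : Prop :=
  [/\ idle s, matrix_of n (ar s 1) = adjacency_matrix adj, sc s 16 = j%:R - 1, sc s 18 = j%:R &
  [/\ forall i l : 'I_n, ar s 4 (i * n + l)%N = (d i l)%:R,
      forall i l : 'I_n, ar s 5 (i * n + l)%N = (lambda i l)%:R,
      forall i l : 'I_n, ar s 3 (i * n + l)%N =
        \sum_(u | adj l u && (d i u == j)) dependency adj i u &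
      forall i l : 'I_n, ar s 6 (i * n + l)%N = if (j <= d i l)%N then dependency adj i l else 0]].

Lemma level_spec j s : levelled j.+1 s ->
  triple n B (cseq level_code (cseq (product_code Q)
    (fun=> compile [:: Osub 16 16 1; Osub 18 18 1]))) (100 * E) s (levelled j).
Proof.
move=> [ids eA s16 s18 [eD eL eZ eY]]; have n2 := large_square n32.
have {}s16 : sc s 16 = j%:R by rewrite s16 -natr1 addrK.
apply: (triple_weaken (t := ((1 + (1 + ((n * n - 0) * (19 + 4) + 1))) + (50 * E + 2))%N)
  (Q := levelled j)) => //; first by lia.
pose new t i := if t == 2%N then level_value s i else
      if t == 6%N then level_value s i + ar s 6 i else ar s t i.
(* On level j the bracket is the right-hand side of [dependency_step]; elsewhere the indicator
   vanishes. *)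
have newE (i l : 'I_n) : level_value s (i * n + l)%N = if d i l == j then dependency adj i l else 0.
  rewrite /level_value eL eZ eD s16; case: eqP => [e|/eqP e].
    by rewrite dependency_step // e subrr mul0r subr0 mulr1.
  by rewrite divff ?subrr ?mulr0 // subr_eq0 eqr_nat.
pose G (i : nat) x := x 16%N = sc s 16 /\ x 18%N = sc s 18 :> rat.
apply: (triple_seq (Q := fun s' => [/\ qm s' = qm s, lg s' = lg s,
    forall t k, ar s' t k = if (0 <= k < n * n)%N then new t k else ar s t k &
    G (n * n)%N (sc s')])).
  apply: (triple_seq (Q := fun s' => [/\ sc s' 8 = 0%:R, qm s' = qm s, lg s' = lg s,
     ar s' = ar s & G 0%N (sc s')])); first exact: triple_ops.
  move=> s1 [s18' q1 l1 a1 G1].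
  apply: triple_weaken (triple_pointwise n32 (s := s1) (E := (n * n)%N) (new := new)
    (G := G) _ _ _ _ _ _ _ s18' G1) => //.
  - by move=> s' [h1 h2 h3 h4]; split; rewrite -?q1 -?l1 // => t k; rewrite h3 a1.
  - exact: constant_square.
  - by move=> i x e y /orP [] /eqP -> [h1 h2].
  move=> i s' iN cs si si' [g1 g2].
  apply: wp_mono (level_body_spec _ cs si) => // s'' [h1 h2 h3 h4 [h5 h6]].
  split=> //; last by rewrite /G h5 h6.
  move=> t k; rewrite h4 /new /level_value !si' a1 g1.
  by case: (k =P i) => [->|].
move=> s1 [q1 l1 a1 [g1 g2]].
apply: triple_seq; first by apply: triple_product => //; rewrite /idle q1 l1.
move=> s2 [id2 e3 old sc2].
have at_cell t (i l : 'I_n) : t != 3%N -> ar s2 t (i * n + l)%N = new t (i * n + l)%N.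
  by move=> t3; rewrite old // a1 flat_lt.
apply: triple_given_constants => cs; have [_ c1 _ _ _] := cs.
apply: triple_ops => //; do 2 (apply: wp_scalar => _ ->); apply: wp_nil; split=> //=.
- by apply/matrixP => i l; rewrite -eA !mxE at_cell.
- by rewrite sc2 // g1 s16 c1.
- by rewrite sc2 // g2 s18 c1 -natr1 addrK.
split=> i l.
- by rewrite at_cell // /new /= eD.
- by rewrite at_cell // /new /= eL.
- have := congr1 (fun M : 'M[rat]_n => M i l) e3; rewrite !mxE => ->.
  rewrite [RHS]big_mkcond; apply: eq_bigr => u _; rewrite !mxE.
  (* The product yields the entry from u to l, the recursion asks for neighbours u of l; symmetry of
     the graph identifies them. *)
  have -> : ar s1 1 (u * n + l)%N = (adj l u)%:R.
    by rewrite a1 flat_lt /new /= adj_sym;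
      have := congr1 (fun M : 'M[rat]_n => M u l) eA; rewrite !mxE.
  rewrite a1 flat_lt /new /= newE.
  by case: adj; case: eqP => _; rewrite ?mulr1 ?mulr0.
- rewrite at_cell // /new /= newE eY.
  by case: (ltngtP j (d i l)) => [h|h|h]; rewrite ?addr0 ?add0r.
Qed.

Lemma dependency_spec s : recorded adj (diam adj) s ->
  triple n B (dependency_code Q) (150 * E * (diam adj).+1) s (fun s' =>
    [/\ idle s', forall i l : 'I_n, ar s' 5 (i * n + l)%N = (lambda i l)%:R &
      forall i l : 'I_n, ar s' 6 (i * n + l)%N = dependency adj i l]).
Proof.
move=> [ids eA eW sk [_ eD eL e6]]; have n2 := large_square n32.
apply: (triple_weaken (t := (1 + ((1 + ((n * n - 0) * (3 + 4) + 1)) +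
   (1 + ((diam adj).+1 * (100 * E + 2) + 1))))%N) (Q := levelled 0)).
- have : (32 <= E)%N by lia.
  have : (n * n <= E)%N by lia.
  by move: E (n * n)%N (diam adj) => e N D Ne e32; nia.
- by move=> s' [h1 h2 h3 h4 [h5 h6 h7 h8]]; split=> // i l; rewrite h8.
apply: (triple_seq (Q := fun s' => [/\ sc s' 8 = 0%:R, qm s' = qm s, lg s' = lg s,
  ar s' = ar s & sc s' 16 = sc s 16])); first exact: triple_ops.
move=> s1 [s18 q1 l1 a1 k1].
apply: (triple_seq (Q := fun s' => [/\ qm s' = qm s, lg s' = lg s,
  forall t k, ar s' t k = if (0 <= k < n * n)%N && (t == 3%N) then 0 else ar s t k &
  sc s' 16 = sc s 16])).
  apply: triple_weaken (triple_pointwise n32 (s := s1) (E := (n * n)%N)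
    (new := fun t k => if t == 3%N then 0 else ar s t k)
    (G := fun _ x => x 16%N = sc s 16) _ _ _ _ _ _ _ s18 k1) => //.
  - move=> s' [h1 h2 h3 h4]; split; rewrite -?q1 -?l1 // => t k.
    by rewrite h3 a1; case: (_ <= _ < _)%N.
  - exact: constant_square.
  - by move=> i x e y /orP [] /eqP ->.
  move=> i s' /= iN cs si si' g1; wp_run i; subst; split=> // t k.
  case: (k =P i) => [->|_]; last by rewrite andbF.
  by rewrite andbT si' a1.
move=> s2 [q2 l2 a2 k2].
apply: (triple_seq (Q := levelled (diam adj).+1)).
  apply: triple_given_constants => cs; have [_ c1 _ _ _] := cs.
  apply: triple_ops => //; apply: wp_scalar => _ ->; apply: wp_nil; split=> //=.
  - by rewrite /idle q2 l2.
  - by rewrite -eA; apply/matrixP => i l; rewrite !mxE a2 andbF.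
  - by rewrite k2 sk -natr1 addrK.
  - by rewrite k2 sk c1 natr1.
  split=> i l; rewrite a2 flat_lt /= ?eD ?eL ?dist_le_diam //.
    (* No vertex lies on level Diam(G) + 1, so the zeroed array is the correct starting value. *)
    rewrite big_pred0 // => u; have := dist_le_diam adj i u.
    by case: eqP => [->|_]; rewrite ?ltnn ?andbF.
  by rewrite e6 ?flat_lt // ltnNge dist_le_diam.
move=> s3 Is3; apply: (triple_while n32 (I := levelled)) => //.
  by move=> j s' [_ _ _ -> _]; rewrite pnatr_eq0.
exact: level_spec.
Qed.

(** Outputs for v < 31 belong in registers still used as scalars; they stay in array 3 until the
    epilogue, while the others go directly to their registers. *)
Lemma sum_spec s : idle s ->
  (forall i l : 'I_n, ar s 5 (i * n + l)%N = (lambda i l)%:R) ->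
  (forall i l : 'I_n, ar s 6 (i * n + l)%N = dependency adj i l) ->
  triple n B (sum_code Q) (150 * E) s (fun s' =>
    (forall v : 'I_n, ar s' 3 v = BC adj v) /\
    (forall v : 'I_n, (31 <= v)%N -> ar s' 0 v = BC adj v)).
Proof.
move=> [q0 l0] eL eY; have n2 := large_square n32.
have nN : (n <= n * n)%N by nia.
apply: (triple_weaken (t := (1 + ((1 + ((n * n - 0) * (9 + 4) + 1)) + (50 * E +
  (3 + ((1 + ((n - 0) * (5 + 4) + 1)) + (1 + (1 + ((n - 31) * (4 + 4) + 1))))))))%N)
  (Q := fun s' => (forall v : 'I_n, ar s' 3 v = BC adj v) /\
    (forall v : 'I_n, (31 <= v)%N -> ar s' 0 v = BC adj v))) => //; first by lia.
apply: (triple_seq (Q := fun s' => [/\ sc s' 8 = 0%:R, qm s' = qm s, lg s' = lg s &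
  ar s' = ar s])); first exact: triple_ops.
move=> s1 [s18 q1 l1 a1].
apply: (triple_seq (Q := fun s' => [/\ qm s' = qm s, lg s' = lg s &
  forall t k, (k < n * n)%N -> ar s' t k = if t == 1%N then ar s 5 k * ar s 6 k else
    if t == 2%N then 1 else ar s t k])).
  apply: triple_weaken (triple_pointwise n32 (s := s1) (E := (n * n)%N)
    (new := fun t k => if t == 1%N then ar s 5 k * ar s 6 k else if t == 2%N then 1 else ar s t k)
    (G := fun _ _ => True) _ _ _ _ _ _ _ s18 I) => //.
  - by move=> s' [h1 h2 h3 h4]; split; rewrite -?q1 -?l1 // => t k kN; rewrite h3 kN.
  - exact: constant_square.
  move=> i s' /= iN cs si si' _; have [_ c1 _ _ _] := cs.
  wp_run i; subst; split=> // t k; rewrite c1 !si' a1.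
  case: (k =P i) => [->|_]; last by rewrite !andbF.
  by rewrite !andbT si' a1; case: t => [|[|[|t]]].
move=> s2 [q2 l2 a2].
apply: triple_seq; first by apply: triple_product => //; rewrite /idle q2 l2.
move=> s3 [_ e3 old3 sc3].
have column (v : 'I_n) : ar s3 3 v = \sum_i (lambda i v)%:R * dependency adj i v.
  have n0 : (0 < n)%N by lia.
  have := congr1 (fun M : 'M[rat]_n => M (Ordinal n0) v) e3; rewrite !mxE /= mul0n add0n => ->.
  by apply: eq_bigr => i _; rewrite !mxE !a2 ?flat_lt //= mul1r eL eY.
pose G (i : nat) (x : nat -> rat) := x 12%N = (2 * n)%:R - 1.
apply: (triple_seq (Q := fun s' => [/\ sc s' 8 = 0%:R, ar s' = ar s3 & G 0%N (sc s')])).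
  apply: triple_given_constants => cs; have [c0 c1 _ _ _] := cs.
  apply: triple_ops => //; do 3 (apply: wp_scalar => _ ->); apply: wp_nil; split=> //=.
  by rewrite /G /= c0 c1 -natrD addnn mul2n.
move=> s4 [s48 a4 G4].
apply: (triple_seq (Q := fun s' => forall t k, (k < n)%N -> ar s' t k =
    if t == 3%N then ar s3 3 k - ((2 * n)%:R - 1) else ar s3 t k)).
  apply: triple_weaken (triple_pointwise n32 (s := s4) (E := n)
    (new := fun t k => if t == 3%N then ar s3 3 k - ((2 * n)%:R - 1) else ar s3 t k)
    (G := G) _ _ _ _ _ _ _ s48 G4) => //.
  - by move=> s' [_ _ h _] t k kn; rewrite h kn.
  - exact: constant_n.
  - by move=> i x e y /orP [] /eqP ->.
  move=> i s' /= iN cs si si' g; have iN2 : (i < n * n)%N by lia.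
  wp_run i; subst; split=> // t k; rewrite g !si' a4.
  case: (k =P i) => [->|_]; last by rewrite andbF.
  by rewrite andbT si' a4.
move=> s5 a5.
have e5 (v : 'I_n) : ar s5 3 v = BC adj v.
  by rewrite a5 //= column BC_dependency // opprB addrCA addrC.
apply: (triple_seq (Q := fun s' => sc s' 8 = 31%:R /\ ar s' = ar s5)); first exact: triple_ops.
move=> s6 [s68 a6].
apply: triple_weaken (triple_pointwise n32 (s := s6) (i0 := 31) (E := n)
    (new := fun t k => if t == 0%N then ar s5 3 k else ar s5 t k)
    (G := fun _ _ => True) _ _ _ _ _ _ _ s68 I) => //; last 2 first.
- exact: constant_n.
- move=> i s' /= /andP [i31 iN] cs si si' g; have iN2 : (i < n * n)%N by lia.
  wp_run i; subst; split=> // t k; rewrite !si' a6.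
  case: (k =P i) => [->|_]; last by rewrite andbF.
  by rewrite andbT si' a6.
- move=> s' [_ _ h _]; split=> [v|v v31]; rewrite h ltn_ord; last by rewrite v31 /=.
  by case: ifP => _ /=; rewrite ?a6.
- by lia.
Qed.

End Phases.

(** * Straight-line prologue and epilogue *)

Definition base_code (k : nat) : seq instr :=
  flatten [seq [:: IConst (20 + t) t%:R; IMul (20 + t) (20 + t) 2;
                  IAdd (20 + t) (20 + t) 1] | t <- iota 0 k].

Definition start_code : seq instr := [:: IConst 11 7; IMul 11 11 2; IAdd 11 11 1;
  IAdd 3 3 2; IAdd 3 3 2; IAdd 3 3 1; IAdd 3 3 11].

(** Register 3 receives a n^m + (2n^2 + 1) + (7n^2 + 1): room for the writes of [Q], room for
    loading its input, and the start of the log. The exponent [m] is fixed with the program, so n^m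
    takes constantly many multiplications. *)
Definition prologue (a m : nat) : seq instr :=
  [:: IConst 1 1; IMul 2 0 0; IConst 3 a%:R] ++ nseq m (IMul 3 3 0) ++
  base_code 7 ++ start_code.

(* The scalars sit on the output registers 1..31, which are therefore filled last, with only
   register 0 as a pointer; register r holds the increment 1 before it receives its output. *)
Definition output_loads (k : nat) : seq instr :=
  flatten [seq [:: IConst r 1; IAdd 0 0 r; ILoad r 0] | r <- iota 1 k].

Definition epilogue : seq instr := [:: ISub 0 23 1] ++ output_loads 31.

Lemma eval_powers (m : memory) k r : foldl eval1 m (nseq k (IMul 3 3 0)) r =
  if r == 3%N then m 3%N * m 0%N ^+ k else m r.
Proof.
elim: k m => [|k IH] m /=; first by rewrite mulr1; case: eqP => [->|].
by rewrite IH /=; case: eqP => // _; rewrite exprS mulrA.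
Qed.

Lemma eval_bases (m : memory) N k : m 1%N = 1 -> m 2%N = N%:R ->
  forall r, foldl eval1 m (base_code k) r =
  if (20 <= r < 20 + k)%N then ((r - 20) * N + 1)%:R else m r.
Proof.
move=> m1 m2; elim: k => [|k IH] r; first by rewrite ifN //; lia.
rewrite /base_code -[k.+1]addn1 iotaD map_cat flatten_cat foldl_cat -/(base_code k) /= !IH add0n.
rewrite eqxx /= m1 m2; case: (r =P (20 + k)%N) => [->|rk].
  by rewrite ifT ?addKn ?natrD ?natrM //; lia.
rewrite (_ : (20 <= r < 20 + (k + 1))%N = (20 <= r < 20 + k)%N) //; lia.
Qed.

Lemma eval_starts (m : memory) r :
  foldl eval1 m start_code r =
  if r == 3%N then m 3%N + m 2%N + m 2%N + m 1%N + (7 * m 2%N + m 1%N) else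
  if r == 11%N then 7 * m 2%N + m 1%N else m r.
Proof. by rewrite /=; case: (r =P 3%N) => [_|_] //; case: (r =P 11%N). Qed.

Lemma eval_prologue (m0 : memory) n a m : m0 0%N = n%:R ->
  constants n (a * n ^ m + (2 * (n * n) + 1)) (foldl eval1 m0 (prologue a m)) /\
  forall r, (32 <= r)%N -> foldl eval1 m0 (prologue a m) r = m0 r.
Proof.
move=> m00; rewrite /prologue foldl_cat.
set ma := foldl eval1 m0 _; rewrite foldl_cat.
set mb := foldl eval1 ma _; rewrite foldl_cat.
set mc := foldl eval1 mb _.
have ea r : mb r = if r == 1%N then 1 else if r == 2%N then (n * n)%:R else
    if r == 3%N then (a * n ^ m)%:R else m0 r.
  rewrite /mb eval_powers /ma /= m00 -!natrM -natrX.
  by case: r => [|[|[|[|r]]]] //=; rewrite natrM.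
have ec r : mc r = if (20 <= r < 27)%N then ((r - 20) * (n * n) + 1)%:R else mb r.
  by apply: eval_bases; rewrite ea.
have ed := eval_starts mc; set md := foldl eval1 mc _ in ed *.
move: md ed => md ed.
split=> [|r r32]; last by rewrite ed !ec !ea !gtn_eqF ?ifN //; lia.
split; rewrite ?ed ?ec ?ea ?m00 //=.
- rewrite -[1]/(1%:R) -[7]/(7%:R) -!natrM -!natrD /q_start /log_start; congr _%:R; lia.
split=> [|t t7]; last first.
  have [t3 t11] : (20 + t == 3)%N = false /\ (20 + t == 11)%N = false by split; lia.
  by rewrite ed t3 t11 ec ifT ?addKn //; lia.
by rewrite -[1]/(1%:R) -[7]/(7%:R) -!natrM -!natrD /log_start.
Qed.

Lemma eval_output_loads (m : memory) b k r : m 0%N = b%:R -> (k <= b)%N ->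
  foldl eval1 m (output_loads k) r =
  if r == 0%N then (b + k)%:R else if (r <= k)%N then m (b + r)%N else m r.
Proof.
move=> mb; elim: k r => [|k IH] r kb.
  by rewrite /= addn0; case: eqP => [->|r0] //; rewrite ifN //; lia.
rewrite /output_loads -[k.+1]addn1 iotaD map_cat flatten_cat foldl_cat.
rewrite -/(output_loads k) /= !IH /=; [|lia..].
rewrite eqxx natr1 -addnS addr_nat add1n.
case: (r =P k.+1) => [->|rk]; first by rewrite addn1 leqnn !ifN //; lia.
case: eqP => [_|r0]; first by rewrite addn1.
by rewrite (_ : (r <= k + 1)%N = (r <= k)%N) //; lia.
Qed.

Lemma eval_epilogue (m : memory) b r : m 23%N - m 1%N = b%:R -> (32 <= b)%N ->
  (0 < r)%N -> foldl eval1 m epilogue r = if (r < 32)%N then m (b + r)%N else m r.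
Proof.
move=> mb b32 r0; rewrite /epilogue foldl_cat (eval_output_loads (b := b)) //=; last by lia.
by rewrite ltnS !(gtn_eqF r0) gtn_eqF //; lia.
Qed.

(** One instruction alters at most one register. *)
Lemma changed_registers Q T st (ks : seq nat) : uniq ks ->
  (count (fun k => regs (run Q T st) k != regs st k) ks <= T)%N.
Proof.
move=> uks; elim: T st => [|T IH] st.
  by rewrite (eq_count (a2 := pred0)) ?count_pred0 // => k; rewrite /= eqxx.
have [k0 hk0] : exists k0, forall k, k != k0 -> regs (step Q st) k = regs st k.
  rewrite regs_step; case: nth => [d q|d a b|d a b|d a b|d a b|d a|a b|a l|a l|l|];
    try (by exists 0%N); try (by exists d => k kd; apply: upd_other).
  by exists (addr (regs st a)) => k ka; apply: upd_other.
rewrite run_step; apply: leq_trans (_ : count (predU (fun k => regs (run Q T (step Q st)) k !=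
  regs (step Q st) k) (pred1 k0)) ks <= _)%N.
  apply: sub_count => k /=; case: (k =P k0) => [|/eqP kk0]; first by rewrite orbT.
  by rewrite hk0 // orbF.
apply: (@leq_trans (count (fun k => regs (run Q T (step Q st)) k !=
  regs (step Q st) k) ks + count (pred1 k0) ks)).
  by rewrite -count_predUI leq_addr.
by rewrite -addn1 leq_add // count_uniq_mem // leq_b1.
Qed.

(* No entry of the product equals the entry of A initially stored in the same register. *)
Lemma matmul_time_ge Q n T (A C : 'M[rat]_n) : (0 < n)%N ->
  A = const_mx 1 -> C = const_mx 2%:R ->
  (forall i j : 'I_n, regs (run Q T (mm_input A C)) (1 + i * n + j)%N = (A *m C) i j) ->
  (n * n <= T)%N.
Proof.
move=> n0 eA eC h; apply: leq_trans (changed_registers Q T (mm_input A C) (iota_uniq 1 (n * n))).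
rewrite (_ : count _ _ = n * n)%N // -[RHS](size_iota 1); apply/eqP; rewrite -all_count.
apply/allP => k; rewrite mem_iota => kn.
have [|i [j e]] := @flat_split n k.-1; first by lia.
have -> : k = (1 + i * n + j)%N by lia.
rewrite h mxE (eq_bigr (fun=> 2%:R)); last by move=> l _; rewrite eA eC !mxE mul1r.
rewrite sumr_const card_ord /= -[(1 + i * n + j)%N]addnA.
have := pick_flat_in 1 (fun i j => A i j)
  (if [pick ij : 'I_n * 'I_n | (1 + n * n + ij.1 * n + ij.2)%N == (1 + (i * n + j))%N]
   is Some ij then C ij.1 ij.2 else 0) i j.
have -> : A i j = 1 by rewrite eA mxE.
move=> ->.
by rewrite -mulrnA -[1]/(1%:R) eqr_nat; lia.
Qed.

(** * Assembling the program *)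

Lemma placed_middle p c r : placed (p ++ c ++ r) (size p) c.
Proof.
by move=> i ic; rewrite nth_cat ltnNge leq_addr /= addKn nth_cat ic.
Qed.

Lemma run_sandwich p c r m m' T : all straight p -> all straight r ->
  run (p ++ c ++ r) T (State (size p) (foldl eval1 m p)) = State (size p + size c) m' ->
  run (p ++ c ++ r) (size p + (T + size r)) (State 0 m) =
    State (size (p ++ c ++ r)) (foldl eval1 m' r).
Proof.
move=> sp sr e; have pl1 : placed (p ++ c ++ r) 0 p by apply: (@placed_middle [::]).
have pl3 : placed (p ++ c ++ r) (size p + size c) r.
  by rewrite -size_cat catA -[X in _ ++ X]cats0; apply: placed_middle.
by rewrite runD (run_straight _ sp pl1) runD e (run_straight _ sr pl3) !size_cat addnA.
Qed.

Lemma graph_input_zero n (adj : rel 'I_n) k : (n * n < k)%N -> regs (graph_input adj) k = 0.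
Proof.
move=> nk; rewrite /graph_input /= gtn_eqF; last by lia.
by rewrite (pick_flat_out (fun i j => (adj i j)%:R)) //; lia.
Qed.

Lemma rep_initial n B (adj : rel 'I_n) (m : memory) : (32 <= n)%N -> constants n B m ->
  (forall r, (32 <= r)%N -> m r = regs (graph_input adj) r) ->
  rep n B (Abstract m (initial_arrays adj) (fun=> 0) [::]) m.
Proof.
move=> n32 cm hm; split=> //=.
- move=> t k t7 kN h32; rewrite hm // /initial_arrays; case: eqP => [->|t0] //.
  by rewrite graph_input_zero //; case: t t0 {t7 h32} => // t _; rewrite mulSn; lia.
- move=> k; rewrite hm ?graph_input_zero // /q_start /log_start; nia.
Qed.

Lemma straight_prologue a m : all straight (prologue a m).
Proof. by rewrite /prologue !all_cat all_nseq orbT. Qed.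

Lemma straight_epilogue : all straight epilogue.
Proof. by []. Qed.

Lemma powR_le_expn (R : realType) (c : R) n m : (0 < n)%N -> c <= m%:R ->
  (n%:R : R) `^ c <= (n ^ m)%:R.
Proof.
move=> n0 cm; rewrite natrX -powR_mulrn //.
by apply: ler_powR => //; rewrite ler1n.
Qed.

(* For every exponent c for which n x n matrix multiplication takes
   O(n^c) unit-cost operations (c = omega), there is a RAM program that,
   on every connected simple graph on n vertices, halts with BC(v) in
   register 1 + v for every vertex v, within O(n^c * Diam(G)) steps. *)
Theorem theorem3p6 (c : Rdefinitions.R) :
  matmul_in_time c ->
  exists (P : program) (K : Rdefinitions.R) (N0 : nat),
    forall (n : nat) (adj : rel 'I_n),
      (N0 <= n)%N -> simple_graph adj -> connected_graph adj ->
      exists T : nat,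
        let st := run P T (graph_input adj) in
        [/\ halted P st,
            (forall v : 'I_n, regs st (1 + v)%N = BC adj v) &
            (T%:R <= K * powR (n%:R) c * (diam adj)%:R)%R].
Proof.
move=> [Q [K [N0 hQ]]].
pose m := Num.truncn `|c|; pose m1 := m.+1.
pose a := (Num.truncn `|K|).+1.
pose main := cseq setup_code (cseq (count_code Q) (cseq (dependency_code Q) (sum_code Q))).
pose pre := prologue a m1; pose b := size pre.
pose P := pre ++ main b ++ epilogue.
pose cst := (2 * (b + size epilogue + 1000))%N.
exists P, (cst%:R * K), (maxn 32 N0) => n adj; rewrite geq_max => /andP [n32 nN0] [irr sym] conn.
have n0 : (0 < n)%N by lia.
(* Step counts are integers, so the real bound may be rounded down. *)
pose TB := Num.truncn (K * powR n%:R c).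
have time_le T : (T%:R <= K * powR n%:R c)%R -> (T <= TB)%N.
  by move=> h; rewrite truncn_ge_nat //; apply: le_trans h.
have Q_correct (A C : 'M[rat]_n) : exists T, [/\ (T <= TB)%N,
  halted Q (run Q T (mm_input A C)) &
  forall i j : 'I_n, regs (run Q T (mm_input A C)) (1 + i * n + j)%N = (A *m C) i j].
  have [T [h1 h2 h3]] := hQ n A C n0 nN0.
  by exists T; split=> //; apply: time_le.
have NTB : (n * n <= TB)%N.
  have [T [TT _ hT]] := Q_correct (const_mx 1) (const_mx 2%:R).
  exact: leq_trans (matmul_time_ge n0 erefl erefl hT) TT.
(* The sign of [K] is not given; any run, here on zero matrices, shows the bound to be
   nonnegative. *)
have Kc0 : 0 <= K * powR n%:R c.
  have [T [_ _ h]] := hQ n 0 0 n0 nN0.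
  by apply: le_trans h; apply: ler0n.
have TB_le : TB%:R <= K * powR n%:R c by rewrite truncn_le.
have TBa : (TB <= a * n ^ m1)%N.
  rewrite -(ler_nat Rdefinitions.R); apply: le_trans TB_le _; rewrite natrM.
  apply: (@le_trans _ _ (`|K| * powR n%:R c)).
    by rewrite ler_wpM2r ?powR_ge0 // ler_norm.
  apply: ler_pM => //; rewrite ?powR_ge0 //; first by apply/ltW/truncnS_gt.
  apply: powR_le_expn => //; apply: le_trans (ler_norm c) _.
  exact/ltW/truncnS_gt.
pose B := (a * n ^ m1 + (2 * (n * n) + 1))%N.
have BT : (2 * (n * n) + 1 + TB <= B)%N by rewrite /B; lia.
have [cm hm] := eval_prologue a m1 (erefl : regs (graph_input adj) 0%N = n%:R).
set mem1 := foldl eval1 _ _ in cm hm.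
have rep1 := rep_initial n32 cm hm.
set s1 := Abstract _ _ _ _ in rep1.
pose E := (n * n + TB)%N; pose D := diam adj.
have main_spec : triple n B main (50 * (n * n) + (150 * E * D.+1 + (150 * E * D.+1 + 150 * E))) s1
    (fun s' => (forall v : 'I_n, ar s' 3 v = BC adj v) /\
               (forall v : 'I_n, (31 <= v)%N -> ar s' 0 v = BC adj v)).
  apply: triple_seq; first exact: (@setup_spec n _ adj n32 irr sym).
  move=> s2 /(count_spec n32 conn BT Q_correct) h.
  apply: triple_seq; first exact: h.
  move=> s3 /(dependency_spec n32 sym conn BT Q_correct) {}h.
  apply: triple_seq; first exact: h.
  by move=> s4 [id4 e5 e6]; apply: sum_spec.
have pl2 : placed P b (main b) by apply: placed_middle.
have [T1 [mem2 [s2 [T1b e2 rep2 [r3 r0]]]]] := tripleP main_spec pl2 rep1.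
exists (b + (T1 + size epilogue))%N => st.
have stE : st = State (size P) (foldl eval1 mem2 epilogue).
  exact: run_sandwich (straight_prologue a m1) straight_epilogue e2.
clearbody st; subst st; split.
- by rewrite /halted nth_default.
- move=> v; have [h3 h0] := (r3 v, r0 v).
  case: rep2 => hs ha _ _ [_ c1 _ _ [_ ct]].
  (* 3n^2 is one less than the base of array 3, so the epilogue loads cell r - 1 into register r. *)
  rewrite /regs (eval_epilogue (b := (3 * (n * n))%N)) //; last 2 first.
  + by rewrite !hs // (ct 3%N) // c1 natrD addrK.
  + by nia.
  have vN : (v < n * n)%N by have := ltn_ord v; nia.
  case: ltnP => v31; first by rewrite addnA ha ?h3 //; lia.
  by rewrite -[(1 + v)%N]/(0 * (n * n) + 1 + v)%N ha ?h0 //; lia.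
have D0 : (0 < D)%N by apply: diam_gt0 => //; lia.
have TBpos : (0 < TB)%N by nia.
(* Since n^2 <= [TB] and [D] >= 1, the terms of the bound on [T1] amount to at most (500 + 450 + 300
   + 300) [TB * D], below the 2000 provided by [cst]. *)
have total : (b + (T1 + size epilogue) <= cst * TB * D)%N.
  rewrite /cst; move: T1b; rewrite /E; move: (size epilogue) => z T1b.
  have h1 : (TB <= TB * D)%N by rewrite leq_pmulr.
  have h2 : (n * n * D <= TB * D)%N by rewrite leq_mul2r NTB orbT.
  have h3 : (b + z <= (b + z) * (TB * D))%N by rewrite leq_pmulr // muln_gt0 TBpos.
  have {}T1b : (T1 <= 500 * (n * n) + 450 * TB + 300 * (n * n * D) + 300 * (TB * D))%N.
    by apply: leq_trans T1b _; apply: eq_leq; ring.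
  rewrite (_ : 2 * (b + z + 1000) * TB * D = 2 * ((b + z) * (TB * D)) + 2000 * (TB * D))%N.
    by lia.
  by ring.
apply: le_trans (_ : (cst * TB * D)%:R <= _); first by rewrite ler_nat.
by rewrite 2!natrM ler_wpM2r // -mulrA ler_wpM2l.
Qed.
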